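(* For every $m \in \mathbb{N}$ and every root $\alpha \in A_2$, the pair $(\mathrm{St}_{A_2}(\mathbb{Z}[t_1,\dots,t_m]), K_{\alpha})$ has relative property $(F_{\mathcal{E}_{uc}})$, where $K_\alpha$ is the root subgroup of $\mathrm{St}_{A_2}(\mathbb{Z}[t_1,\dots,t_m])$ corresponding to $\alpha$.
   Context: For a topological group $\Gamma$, a subgroup $K<\Gamma$ and a Banach space $\mathbb{E}$, the pair $(\Gamma,K)$ has relative property $(F_{\mathbb{E}})$ if every continuous affine isometric action of $\Gamma$ on $\mathbb{E}$ has a $K$-fixed point; for a class $\mathcal{E}$ of Banach spaces it has relative property $(F_{\mathcal{E}})$ if it has relative property $(F_{\mathbb{E}})$ for every $\mathbb{E}\in\mathcal{E}$. The groups here are discrete. $\mathcal{E}_{uc}$ is the class of all uniformly convex Banach spaces, where $\mathbb{E}$ is uniformly convex if there is $\delta:(0,2]\to(0,1]$ such that for all unit vectors $\xi,\eta\in\mathbb{E}$, $\|\xi-\eta\|\ge\varepsilon$ implies $\|\frac{\xi+\eta}{2}\|\le 1-\delta(\varepsilon)$. For a commutative unital ring $R$, $\mathrm{St}_{A_2}(R)$ is the group generated by $\{x_{i,j}(p):1\le i,j\le 3,\ i\ne j,\ p\in R\}$ subject to the relations: (1) $x_{i,j}(p_1)x_{i,j}(p_2)=x_{i,j}(p_1+p_2)$ for $i\ne j$; (2) $[x_{i,j}(p_1),x_{j,k}(p_2)]=x_{i,k}(p_1p_2)$ for pairwise distinct $i,j,k$; (3) $[x_{i,j}(p_1),x_{i,k}(p_2)]=[x_{j,i}(p_1),x_{k,i}(p_2)]=e$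 for pairwise distinct $i,j,k$ (all $p_1,p_2\in R$). The six roots of $A_2$ correspond to the pairs $(i,j)$, $i\neq j$, and the root subgroups are $K_{i,j}=\{x_{i,j}(p):p\in R\}$. *)

(* Defs.v *)
From HB Require Import structures.
From mathcomp Require Import all_boot all_order all_algebra.
From mathcomp Require Import all_classical all_reals all_analysis.
(* The notations of mpoly clash with those of mathcomp-analysis;
   [mpoly m A] is the ring A[t_1, .., t_m]. *)
From mathcomp Require Export -(notations) mpoly.

Set Implicit Arguments.
Unset Strict Implicit.
Unset Printing Implicit Defensive.

Import Order.TTheory GRing.Theory Num.Theory.
Import numFieldNormedType.Exports.

Local Open Scope classical_set_scope.
Local Open Scope quotient_scope.
Local Open Scope ring_scope.

HB.mixin Record isTopologicalGroup G of Group G & Topological G := {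
  mulg_continuous : continuous (fun xy : G * G => (xy.1 * xy.2)%g);
  invg_continuous : continuous (fun x : G => (x^-1)%g)
}.

#[short(type="topologicalGroupType")]
HB.structure Definition TopologicalGroup :=
  {G of Group G & Topological G & isTopologicalGroup G}.

Definition is_subgroup (G : groupType) (K : set G) : Prop :=
  [/\ K 1%g, forall g h, K g -> K h -> K (g * h)%g
    & forall g, K g -> K (g^-1)%g].

Definition affine_map (R : realType) (E : completeNormedModType R)
    (f : E -> E) : Prop :=
  exists (T : {linear E -> E}) (b : E), forall v, f v = T v + b.

Record continuous_affine_isometric_action (R : realType)
    (G : topologicalGroupType) (E : completeNormedModType R)
    (rho : G -> E -> E) : Prop := {
  action1 : forall v, rho 1%g v = v;
  actionM : forall g h v, rho (g * h)%g v = rho g (rho h v);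
  action_affine : forall g, affine_map (rho g);
  action_isometric : forall g v w, `|rho g v - rho g w| = `|v - w|;
  action_continuous : continuous (fun gv : G * E => rho gv.1 gv.2)
}.

Definition relative_property_F (R : realType) (G : topologicalGroupType)
    (K : set G) (E : completeNormedModType R) : Prop :=
  forall rho : G -> E -> E, continuous_affine_isometric_action rho ->
    exists v : E, forall g, K g -> rho g v = v.

Definition relative_property_F_class (R : realType)
    (G : topologicalGroupType) (K : set G)
    (C : completeNormedModType R -> Prop) : Prop :=
  forall E : completeNormedModType R, C E -> relative_property_F K E.

Definition uniformly_convex (R : realType) (E : completeNormedModType R) :
    Prop :=
  exists delta : R -> R,
    (forall eps, 0 < eps <= 2 -> 0 < delta eps <= 1) /\
    (forall eps, 0 < eps <= 2 ->
     forall xi eta : E, `|xi| = 1 -> `|eta| = 1 -> eps <= `|xi - eta| ->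
       `|2^-1 *: (xi + eta)| <= 1 - delta eps).

(* In a word, the letter (x, false) stands for x and (x, true) for x^-1. *)
Definition word (X : Type) := seq (X * bool).

Definition word_inv (X : Type) (w : word X) : word X :=
  rev [seq (l.1, ~~ l.2) | l <- w].

(* [u, v] = u v u^-1 v^-1.  For the relations below the convention
   u^-1 v^-1 u v gives the same group: x(p)^-1 = x(-p), and p, q range over
   the whole ring. *)
Definition word_comm (X : Type) (u v : word X) : word X :=
  u ++ v ++ word_inv u ++ word_inv v.

Inductive presented_eq (X : Type) (rels : word X -> word X -> Prop) :
    word X -> word X -> Prop :=
| presented_eq_refl u : presented_eq rels u u
| presented_eq_sym u v : presented_eq rels u v -> presented_eq rels v u
| presented_eq_trans v u w :
    presented_eq rels u v -> presented_eq rels v w -> presented_eq rels u w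
| presented_eq_cat u u' v v' :
    presented_eq rels u u' -> presented_eq rels v v' ->
    presented_eq rels (u ++ v) (u' ++ v')
| presented_eq_cancel x b : presented_eq rels [:: (x, b); (x, ~~ b)] [::]
| presented_eq_rel u v : rels u v -> presented_eq rels u v.

Definition presented_eqb (X : choiceType) (rels : word X -> word X -> Prop) :
    rel (word X) := fun u v => `[< presented_eq rels u v >].

Lemma presented_eqb_equiv (X : choiceType) (rels : word X -> word X -> Prop) :
  equiv_class_of (presented_eqb rels).
Proof.
split.
- by move=> u; apply/asboolP; exact: presented_eq_refl.
- by move=> u v; apply/asboolP/asboolP; exact: presented_eq_sym.
- move=> v u w /asboolP uv /asboolP vw; apply/asboolP.
  exact: presented_eq_trans uv vw.
Qed.

Canonical presented_equiv (X : choiceType)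
    (rels : word X -> word X -> Prop) : equiv_rel (word X) :=
  EquivRelPack (presented_eqb_equiv rels).

Definition presented_group (X : choiceType)
    (rels : word X -> word X -> Prop) : Type :=
  {eq_quot presented_equiv rels}.

HB.instance Definition _ (X : choiceType) (rels : word X -> word X -> Prop) :=
  Choice.on (presented_group rels).
HB.instance Definition _ (X : choiceType) (rels : word X -> word X -> Prop) :=
  EqQuotient.on (presented_group rels).

Section PresentedGroupTheory.
Variables (X : choiceType) (rels : word X -> word X -> Prop).
Local Notation G := (presented_group rels).

Definition presented_class (w : word X) : G := \pi_G w.

Lemma presented_classP u v :
  presented_class u = presented_class v <-> presented_eq rels u v.
Proof.
split=> [/eqP|uv]; first by rewrite piE => /asboolP.
by apply/eqP; rewrite piE; apply/asboolP.
Qed.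

Lemma presented_class_repr (g : G) : presented_class (repr g) = g.
Proof. exact: reprK. Qed.

Lemma presented_class_ind (P : G -> Prop) :
  (forall w, P (presented_class w)) -> forall g, P g.
Proof. by move=> Pw g; rewrite -(presented_class_repr g). Qed.

Lemma word_invK : involutive (@word_inv X).
Proof.
move=> w; rewrite /word_inv map_rev revK -map_comp -[RHS]map_id.
by apply: eq_map => -[x b] /=; rewrite negbK.
Qed.

Lemma presented_eq_catV w : presented_eq rels (w ++ word_inv w) [::].
Proof.
elim: w => [|[x b] w IHw]; first exact: presented_eq_refl.
have -> : ((x, b) :: w) ++ word_inv ((x, b) :: w) =
    ([:: (x, b)] ++ (w ++ word_inv w)) ++ [:: (x, ~~ b)].
  by rewrite /word_inv /= rev_cons -cats1 catA.
apply: (presented_eq_trans (v := ([:: (x, b)] ++ [::]) ++ [:: (x, ~~ b)])).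
  apply: presented_eq_cat; last exact: presented_eq_refl.
  by apply: presented_eq_cat => //; exact: presented_eq_refl.
exact: presented_eq_cancel.
Qed.

Lemma presented_eq_inv u v :
  presented_eq rels u v -> presented_eq rels (word_inv u) (word_inv v).
Proof.
move=> uv.
apply: (presented_eq_trans (v := word_inv u ++ (v ++ word_inv v))).
  rewrite -[X in presented_eq _ X _]cats0.
  apply: presented_eq_cat; first exact: presented_eq_refl.
  exact/presented_eq_sym/presented_eq_catV.
rewrite catA -[X in presented_eq _ _ X]cat0s.
apply: presented_eq_cat; last exact: presented_eq_refl.
apply: (presented_eq_trans (v := word_inv u ++ u)).
  apply: presented_eq_cat; first exact: presented_eq_refl.
  exact: presented_eq_sym.
by rewrite -{2}(word_invK u); exact: presented_eq_catV.
Qed.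

Definition presented_one : G := presented_class [::].
Definition presented_mul (g h : G) : G := presented_class (repr g ++ repr h).
Definition presented_inv (g : G) : G := presented_class (word_inv (repr g)).

Lemma presented_reprP w : presented_eq rels (repr (presented_class w)) w.
Proof. by apply/presented_classP; rewrite presented_class_repr. Qed.

Lemma presented_mulE u v :
  presented_mul (presented_class u) (presented_class v) =
  presented_class (u ++ v).
Proof. by apply/presented_classP/presented_eq_cat; exact: presented_reprP. Qed.

Lemma presented_invE u :
  presented_inv (presented_class u) = presented_class (word_inv u).
Proof. by apply/presented_classP/presented_eq_inv; exact: presented_reprP. Qed.

Lemma presented_mulA : associative presented_mul.
Proof.
elim/presented_class_ind => u; elim/presented_class_ind => v.
by elim/presented_class_ind => w; rewrite !presented_mulE catA.
Qed.

Lemma presented_mul1 : left_id presented_one presented_mul.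
Proof. by elim/presented_class_ind => u; rewrite presented_mulE. Qed.

Lemma presented_mulr1 : right_id presented_one presented_mul.
Proof. by elim/presented_class_ind => u; rewrite presented_mulE cats0. Qed.

Lemma presented_mulV : right_inverse presented_one presented_inv presented_mul.
Proof.
elim/presented_class_ind => w; rewrite presented_invE presented_mulE.
exact/presented_classP/presented_eq_catV.
Qed.

Lemma presented_mulVl : left_inverse presented_one presented_inv presented_mul.
Proof.
elim/presented_class_ind => w; rewrite presented_invE presented_mulE.
rewrite -{2}(word_invK w); exact/presented_classP/presented_eq_catV.
Qed.

HB.instance Definition _ := isGroup.Build (presented_group rels)
  presented_mulA presented_mul1 presented_mulr1 presented_mulVl presented_mulV.

(* Presented groups carry the discrete topology. *)
HB.instance Definition _ :=
  hasNbhs.Build (presented_group rels) principal_filter.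
HB.instance Definition _ :=
  Discrete_ofNbhs.Build (presented_group rels) erefl.

Lemma presented_mulg_continuous :
  continuous (fun xy : G * G => (xy.1 * xy.2)%g).
Proof.
move=> [g h] A /=; rewrite nbhs_principalE => /principal_filterP gh.
exists ([set g], [set h]); first by split; exact: discrete_set1.
by move=> [a b] /= [-> ->].
Qed.

Lemma presented_invg_continuous : continuous (fun g : G => (g^-1)%g).
Proof.
move=> g A; rewrite nbhs_principalE => /principal_filterP gA.
by rewrite [nbhs _ A]/(principal_filter g _); apply/principal_filterP.
Qed.

HB.instance Definition _ := isTopologicalGroup.Build (presented_group rels)
  presented_mulg_continuous presented_invg_continuous.

End PresentedGroupTheory.

(* The root e_i - e_j of A_2 is encoded by the pair (i, j). *)
Definition A2_root : choiceType := {ij : 'I_3 * 'I_3 | ij.1 != ij.2}.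

Section Steinberg.
Variable A : comNzRingType.

Definition steinberg_word (alpha : A2_root) (p : A) : word (A2_root * A) :=
  [:: (alpha, p, false)].

Local Notation x ij p := (steinberg_word (exist _ (_, _) ij) p).

Inductive steinberg_rel : word (A2_root * A) -> word (A2_root * A) -> Prop :=
| steinberg_add (i j : 'I_3) (ij : i != j) (p1 p2 : A) :
    steinberg_rel (x ij p1 ++ x ij p2) (x ij (p1 + p2))
| steinberg_comm (i j k : 'I_3) (ij : i != j) (jk : j != k) (ik : i != k)
    (p1 p2 : A) :
    steinberg_rel (word_comm (x ij p1) (x jk p2)) (x ik (p1 * p2))
| steinberg_row (i j k : 'I_3) (ij : i != j) (ik : i != k) (jk : j != k)
    (p1 p2 : A) :
    steinberg_rel (word_comm (x ij p1) (x ik p2)) [::]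
| steinberg_col (i j k : 'I_3) (ji : j != i) (ki : k != i) (jk : j != k)
    (p1 p2 : A) :
    steinberg_rel (word_comm (x ji p1) (x ki p2)) [::].

Definition steinberg_group : topologicalGroupType :=
  presented_group steinberg_rel.

Definition steinberg_gen (alpha : A2_root) (p : A) : steinberg_group :=
  presented_class steinberg_rel (steinberg_word alpha p).

Definition root_subgroup (alpha : A2_root) : set steinberg_group :=
  range (steinberg_gen alpha).

Lemma steinberg_genD alpha p q :
  steinberg_gen alpha (p + q) =
  (steinberg_gen alpha p * steinberg_gen alpha q)%g.
Proof.
apply: esym; rewrite [LHS]presented_mulE; apply/presented_classP.
apply: presented_eq_rel; case: alpha => -[i j] ij.
exact: (steinberg_add ij).
Qed.

Lemma root_subgroupP alpha : is_subgroup (root_subgroup alpha).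
Proof.
have gen0 : steinberg_gen alpha 0 = 1%g.
  have := steinberg_genD alpha 0 0; rewrite addr0 => /esym e.
  by apply: (mulgI (steinberg_gen alpha 0)); rewrite mulg1.
split; first by exists 0.
- by move=> _ _ [p _ <-] [q _ <-]; exists (p + q) => //; rewrite steinberg_genD.
- move=> _ [p _ <-]; exists (- p) => //.
  apply: (mulgI (steinberg_gen alpha p)).
  by rewrite -steinberg_genD subrr gen0 mulgV.
Qed.

End Steinberg.

(* Main.v *)
Require Import Defs.
From mathcomp Require Import all_boot all_order all_algebra.
From mathcomp Require Import all_classical all_reals all_analysis.
From mathcomp Require Import zify ring lra.

(** For a list of group elements [g1, .., gr] acting on [E], consider the
    average [(1 + g1) / 2 * .. * (1 + gr) / 2]. We average over boxes: all
    root elements of a given root at the monomials [2 ^ b * t ^ I] of degree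
    [b + |I| < d]. The scalar 2 counts as one more variable, and averaging over
    [N, 2 N, 4 N, ..] is averaging over consecutive powers. So a box nearly
    absorbs the root elements at monomials of degree less than [d - k], up to an
    error [2 ^ -k] ([box_absorbs]).

    Let [Z] be the commutator root of [X] and [Y], and consider a product of
    three boxes [X Z Y] of sizes [a], [c], [b].
    - If [c] exceeds [a + b], the box of [Z] absorbs all commutators, hence
      [X Z Y] and [Y Z X] nearly agree ([box_reverse]).
    - If [c] is less than [a + b], by a margin, then the box of [Z] can be
      enlarged, at the cost of an error [lam ^ k] with [lam < 1] and [k] of the
      order of the square root of the sizes ([box_insert]). This is where
      uniform convexity enters: if averaging over [X] does not shorten a vector
      [u] by the factor [lam], then [X] nearly fixes [u]; if [Y] nearly fixes
      it too, then so does the commutator [z]. But [u] is the image of a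
      displacement [p - z p], and [u + z u] is that of [p - z ^ 2 p]; so the
      displacements double along the powers [z ^ (2 ^ g)], which they cannot do
      for long as they are bounded.

    Every root of [A_2] is the sum of its two neighbours in the hexagon. The
    word [hexagon n] is a product of six boxes, one for each root, with sizes
    proportional to [n], chosen such that a few reversals and insertions lead
    from [n] to a larger [n'] ([hexagon_step]). The errors also contain the
    displacements of a point by root elements. These are polynomial in the
    degree, as the root element of a product of two monomials is a commutator
    ([root_displacement]). For [n] quadratic in [k] the errors are thus
    summable over [k], and the images of a point under these words converge; by
    absorption the limit is fixed by a root subgroup. *)

Set Implicit Arguments.
Unset Strict Implicit.
Unset Printing Implicit Defensive.

Import Order.TTheory GRing.Theory Num.Theory.
Import numFieldNormedType.Exports.

Local Open Scope ring_scope.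

(** * Averages along lists of group elements *)

Section Averages.
Variables (R : realType) (G : groupType) (E : normedModType R).
Implicit Types (rho : G -> E -> E) (g h : G) (l : seq G) (u v w : E).

(** Midpoints are all that is used of affinity, so that a linear isometric
    representation is an instance as well as an affine action. *)
Record isometric_midpoint_action rho : Prop := {
  mact1 : forall v, rho 1%g v = v;
  mactM : forall g h v, rho (g * h)%g v = rho g (rho h v);
  mact_mid : forall g v w,
    rho g (2^-1 *: (v + w)) = 2^-1 *: (rho g v + rho g w);
  mact_iso : forall g v w, `|rho g v - rho g w| = `|v - w|
}.

Definition average rho l v : E :=
  foldr (fun g u => 2^-1 *: (u + rho g u)) v l.

Lemma average_cat rho l1 l2 v :
  average rho (l1 ++ l2) v = average rho l1 (average rho l2 v).
Proof. exact: foldr_cat. Qed.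

Lemma half_addrr v : 2^-1 *: (v + v) = v.
Proof.
by rewrite scalerDr -scalerDl -[RHS]scale1r; congr (_ *: _); lra.
Qed.

Lemma norm_half_add v w (a : R) :
  `|v| <= a -> `|w| <= a -> `|2^-1 *: (v + w)| <= a.
Proof.
move=> va wa; rewrite normrZ ger0_norm ?invr_ge0//.
by have := ler_normD v w; lra.
Qed.

Variable rho : G -> E -> E.
Hypothesis rhoP : isometric_midpoint_action rho.

Lemma mactVK g v : rho g^-1%g (rho g v) = v.
Proof. by rewrite -(mactM rhoP) mulVg (mact1 rhoP). Qed.

Lemma mactKV g v : rho g (rho g^-1%g v) = v.
Proof. by rewrite -(mactM rhoP) mulgV (mact1 rhoP). Qed.

Lemma displacementV g v : `|rho g^-1%g v - v| = `|rho g v - v|.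
Proof. by rewrite -(mact_iso rhoP g) mactKV distrC. Qed.

Lemma displacementM g h v :
  `|rho (g * h)%g v - v| <= `|rho g v - v| + `|rho h v - v|.
Proof.
rewrite (mactM rhoP) [leRHS]addrC (le_trans (ler_distD (rho g v) _ _))//.
by rewrite (mact_iso rhoP).
Qed.

Lemma displacement_dist g v w :
  `|rho g w - w| <= `|rho g v - v| + 2 * `|w - v|.
Proof.
have := ler_distD (rho g v) (rho g w) w; have := ler_distD v (rho g v) w.
by rewrite (mact_iso rhoP) (distrC v w); lra.
Qed.

Lemma average_dist l v w : `|average rho l v - average rho l w| <= `|v - w|.
Proof.
elim: l => //= g l IHl.
rewrite -scalerBr opprD addrACA norm_half_add//.
by rewrite (mact_iso rhoP).
Qed.

Lemma average_displacement l v (B : R) :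
  (forall g, g \in l -> `|rho g v - v| <= B) ->
  `|average rho l v - v| <= (size l)%:R * B.
Proof.
elim: l => [|g l IHl] lB /=; first by rewrite subrr normr0 mul0r.
have IH := IHl (fun h hl => lB h (mem_behead (s := g :: l) hl)).
have gB := lB g (mem_head _ _).
have B0 : 0 <= B by apply: le_trans gB.
set u := average rho l v in IH *.
rewrite -[X in _ - X]half_addrr -scalerBr opprD addrACA norm_half_add//.
  by rewrite (le_trans IH)// ler_wpM2r// ler_nat.
rewrite (le_trans (ler_distD (rho g v) _ _))// (mact_iso rhoP).
by rewrite -natr1 mulrDl mul1r lerD.
Qed.

Lemma mact_average g l v :
  (forall h, h \in l -> commute g h) ->
  rho g (average rho l v) = average rho l (rho g v).
Proof.
elim: l => //= h l IHl gl; rewrite (mact_mid rhoP).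
rewrite IHl => [|h' h'l]; last by apply: gl; rewrite in_cons h'l orbT.
congr (2^-1 *: (_ + _)).
rewrite -(mactM rhoP) gl ?mem_head// (mactM rhoP) IHl// => h' h'l.
by apply: gl; rewrite in_cons h'l orbT.
Qed.

Lemma average_mid l v w : average rho l (2^-1 *: (v + w)) =
  2^-1 *: (average rho l v + average rho l w).
Proof.
elim: l => //= g l ->; rewrite (mact_mid rhoP).
by rewrite -!scalerDr addrACA.
Qed.

Lemma average_comm l1 l2 v :
  (forall g h, g \in l1 -> h \in l2 -> commute g h) ->
  average rho l1 (average rho l2 v) = average rho l2 (average rho l1 v).
Proof.
elim: l2 => //= h l2 IHl2 c12; rewrite average_mid -mact_average => [|g gl1]; last first.
  by apply/commute_sym/c12; rewrite ?mem_head.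
by rewrite IHl2// => g h' gl1 h'l2; apply: c12; rewrite // in_cons h'l2 orbT.
Qed.

Lemma displacement_average g l v :
  (forall h, h \in l -> commute g h) ->
  `|rho g (average rho l v) - average rho l v| <= `|rho g v - v|.
Proof. by move=> gl; rewrite mact_average// average_dist. Qed.

Lemma average_perm l1 l2 v :
  (forall g h, g \in l1 -> h \in l1 -> commute g h) ->
  perm_eq l1 l2 -> average rho l1 v = average rho l2 v.
Proof.
elim: l1 l2 => [|g l1 IHl1] l2 c1 p12.
  by have := perm_size p12; case: l2 {p12}.
have gl2 : g \in l2 by rewrite -(perm_mem p12) mem_head.
case/splitPr: gl2 p12 => l3 l4 p12.
have p1 : perm_eq l1 (l3 ++ l4).
  by rewrite -(perm_cons g) (perm_trans p12)// perm_catC /= perm_cons perm_catC.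
rewrite -(cat1s g l4) catA average_cat average_cat.
rewrite average_comm => [|g1 g2 g1l]; last first.
  rewrite mem_seq1 => /eqP ->; apply: c1; last exact: mem_head.
  by rewrite in_cons (perm_mem p1) mem_cat g1l orbT.
rewrite -average_cat /= -average_cat -(IHl1 _ _ p1)// => g1 g2 g1l g2l.
by apply: c1; rewrite in_cons ?g1l ?g2l orbT.
Qed.

(** Averaging over [h 0, h 0 ^ 2, h 0 ^ 4, ..] is averaging over consecutive
    powers of [h 0]; the displacement telescopes. *)
Lemma displacement_dyadic_chain (h : nat -> G) t v :
  (forall b, h b.+1 = h b * h b)%g ->
  let u := average rho [seq h b | b <- iota 0 t] v in
  `|rho (h 0) u - u| = 2 ^- t * `|rho (h t) v - v|.
Proof.
elim: t h => [|t IHt] h hS /=; first by rewrite expr0 invr1 mul1r.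
have := IHt (fun b => h b.+1) (fun b => hS b.+1).
rewrite /= (_ : [seq h b.+1 | b <- iota 0 t] = [seq h b | b <- iota 1 t]).
  set u := average rho _ v => IH.
  have -> : rho (h 0) (2^-1 *: (u + rho (h 0) u)) - 2^-1 *: (u + rho (h 0) u)
      = 2^-1 *: (rho (h 1) u - u).
    rewrite (mact_mid rhoP) -(mactM rhoP) -hS -scalerBr.
    by rewrite [rho (h 0) u + _]addrC [u + _]addrC opprD addrA addrK.
  by rewrite normrZ ger0_norm ?invr_ge0// IH exprS invfM mulrA.
by rewrite (iotaDl 1 0) -map_comp.
Qed.

(** Exchanging two lists that commute up to elements which hardly move the
    point. *)
Lemma average_almost_comm l1 l2 v (e : R) :
  (forall g h, g \in l1 -> h \in l2 -> exists z : G,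
    [/\ (g * h = h * g * z)%g, forall k, k \in l1 ++ l2 -> commute z k
      & `|rho z v - v| <= e]) ->
  `|average rho l1 (average rho l2 v) - average rho l2 (average rho l1 v)|
    <= (size l1)%:R * (size l2)%:R * e.
Proof.
have one g l u : (forall h, h \in l -> exists z : G,
    [/\ (g * h = h * g * z)%g, forall k, k \in l -> commute z k
      & `|rho z u - u| <= e]) ->
    `|rho g (average rho l u) - average rho l (rho g u)| <= (size l)%:R * e.
  elim: l => [|h l IHl] gl /=; first by rewrite subrr normr0 mul0r.
  have {}IHl : `|rho g (average rho l u) - average rho l (rho g u)|
      <= (size l)%:R * e.
    apply: IHl => k kl; have [|z [zE zc ze]] := gl k.
      by rewrite in_cons kl orbT.
    by exists z; split => // k' k'l; apply: zc; rewrite in_cons k'l orbT.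
  have [|z [zE zc ze]] := gl h; first exact: mem_head.
  have e0 : 0 <= e by apply: le_trans ze.
  rewrite (mact_mid rhoP) -scalerBr opprD addrACA norm_half_add//.
    by rewrite (le_trans IHl)// ler_wpM2r// ler_nat.
  rewrite -(mactM rhoP) zE !(mactM rhoP).
  rewrite (le_trans (ler_distD (rho h (rho g (average rho l u))) _ _))//.
  rewrite !(mact_iso rhoP) -natr1 mulrDl mul1r addrC lerD//.
  rewrite (le_trans (displacement_average _ _))// => k kl.
  by apply: zc; rewrite in_cons kl orbT.
elim: l1 => [|g l1 IHl1] c12 /=.
  by rewrite subrr normr0 !mul0r.
have {}IHl1 : `|average rho l1 (average rho l2 v) -
    average rho l2 (average rho l1 v)| <= (size l1)%:R * (size l2)%:R * e.
  apply: IHl1 => k h kl1 hl2; have [||z [zE zc ze]] := c12 k h => //.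
    by rewrite in_cons kl1 orbT.
  by exists z; split => // k' k'l; apply: zc; rewrite in_cons k'l orbT.
case: (posnP (size l2)) => [/size0nil -> /=|l2_gt0].
  by rewrite subrr normr0 mulr0 mul0r.
have e0 : 0 <= e.
  case: (l2) l2_gt0 c12 => //= h l' _ /(_ g h (mem_head _ _) (mem_head _ _)).
  by move=> [z [_ _]]; apply: le_trans.
rewrite average_mid -scalerBr opprD addrACA norm_half_add//.
  by rewrite (le_trans IHl1)// !ler_wpM2r ?ler_nat ?mulr_ge0.
rewrite (le_trans (ler_distD (rho g (average rho l2 (average rho l1 v))) _ _))//.
rewrite (mact_iso rhoP) -natr1 mulrDl mul1r mulrDl lerD//.
apply: one => h hl2; have [||z [zE zc ze]] := c12 g h => //.
  exact: mem_head.
exists z; split => //.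
  by move=> k kl2; apply: zc; rewrite mem_cat kl2 orbT.
apply: le_trans ze; apply: displacement_average => k kl1.
by apply: zc; rewrite mem_cat in_cons kl1 orbT.
Qed.

End Averages.

(** * Linear parts and the decay estimate for Heisenberg relations *)

Section LinearPart.
Variables (R : realType) (G : groupType).

Record isometric_representation (E : normedModType R) (pi : G -> E -> E) :
    Prop := {
  rep_act :> isometric_midpoint_action pi;
  repD : forall g v w, pi g (v + w) = pi g v + pi g w
}.

Definition linear_part (E : normedModType R) (rho : G -> E -> E) g v : E :=
  rho g v - rho g 0.

Lemma average_linear_part (E : normedModType R) (rho pi : G -> E -> E) l v w :
  (forall g v w, pi g (v - w) = rho g v - rho g w) ->
  average pi l (v - w) = average rho l v - average rho l w.
Proof.
move=> piB; elim: l => //= g l ->.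
by rewrite piB -scalerBr opprD addrACA.
Qed.

Section Representation.
Variables (E : normedModType R) (pi : G -> E -> E).
Hypothesis piP : isometric_representation pi.

Lemma rep0 g : pi g 0 = 0.
Proof. by apply: (addrI (pi g 0)); rewrite -(repD piP) !addr0. Qed.

Lemma rep_norm g v : `|pi g v| = `|v|.
Proof. by have := mact_iso piP g v 0; rewrite rep0 !subr0. Qed.

Lemma averageD l v w :
  average pi l (v + w) = average pi l v + average pi l w.
Proof.
by elim: l => //= g l ->; rewrite (repD piP) -scalerDr addrACA.
Qed.

Lemma average_norm l v : `|average pi l v| <= `|v|.
Proof.
have a0 : average pi l 0 = 0 by elim: l => //= g l ->; rewrite rep0 addr0 scaler0.
by have := average_dist piP l v 0; rewrite a0 !subr0.
Qed.

(** One averaging step either contracts [u] by the factor [lam], or [x] hardly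
    moves [u]; as [y] hardly moves it by hypothesis, neither does the commutator
    [z] of [x] and [y], and then [u + pi z u] is almost twice as long as [u]. *)
Lemma heisenberg_step (lam : R) (x y c z : G) u :
  4 / 7 <= lam ->
  (forall u w : E, `|w| = `|u| -> 16^-1 * `|u| <= `|u - w| ->
     `|2^-1 *: (u + w)| <= lam * `|u|) ->
  (y * x = x * y * c)%g -> c = z \/ c = (z^-1)%g ->
  `|pi y u - u| <= 16^-1 * `|u| ->
  `|2^-1 *: (u + pi x u)| <= lam * `|u| \/
  `|u| <= lam * `|u + pi z u|.
Proof.
move=> lam47 uc yx cz yu.
have [xu|xu] := lerP (16^-1 * `|u|) `|u - pi x u|.
  by left; apply: uc; rewrite ?rep_norm.
right.
have cu : `|pi c u - u| <= 4 / 16 * `|u|.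
  rewrite -(mact_iso piP (x * y)%g) -(mactM piP) -yx !(mactM piP).
  have d1 : `|pi y (pi x u) - pi y u| = `|u - pi x u|.
    by rewrite (mact_iso piP) distrC.
  have d2 : `|pi x u - pi x (pi y u)| = `|pi y u - u|.
    by rewrite (mact_iso piP) distrC.
  have := ler_distD (pi y u) (pi y (pi x u)) (pi x (pi y u)).
  have := ler_distD u (pi y u) (pi x (pi y u)).
  have := ler_distD (pi x u) u (pi x (pi y u)).
  by move: d1 d2 yu xu; lra.
have zu : `|pi z u - u| <= 4 / 16 * `|u|.
  by case: cz cu => ->; rewrite // (displacementV piP).
have : `|u + u| <= `|u + pi z u| + `|pi z u - u|.
  rewrite -[X in _ <= _ + X]normrN opprB; apply: le_trans (ler_normD _ _).
  by rewrite addrACA subrr addr0.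
have -> : `|u + u| = 2 * `|u|.
  by rewrite -[in LHS](scale1r u) -scalerDl normrZ ger0_norm.
have : 0 <= `|u + pi z u| by [].
by move: lam47 zu; nra.
Qed.

(** The vectors [e g] stand for the displacements of a point by [z g], where
    [z g.+1] is the square of [z g]. By [heisenberg_step], each of the [k]
    averaging steps either contracts the vector or lets its successor, of
    index [g.+1], take its place at the same gain; the bound [W] on the vectors
    up to index [k] then suffices. The auxiliary [y g s] commutes with the
    earlier elements [x i] only up to some [c] that hardly moves [e g], and
    once the vector is shorter than the resulting error there is nothing left
    to prove. *)
Lemma heisenberg_decay (lam W W' eta : R) (k : nat) (x z : nat -> G)
    (y : nat -> nat -> G) (e : nat -> E) :
  4 / 7 <= lam ->
  (forall u w : E, `|w| = `|u| -> 16^-1 * `|u| <= `|u - w| ->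
     `|2^-1 *: (u + w)| <= lam * `|u|) ->
  W <= W' -> 16 * (k.+1%:R * eta) <= lam ^+ k * W' -> lam <= 1 ->
  (forall g, (g <= k)%N -> `|e g| <= W) ->
  (forall g, (g < k)%N -> e g.+1 = e g + pi (z g) (e g)) ->
  (forall g s, (g <= k)%N -> (s < k)%N -> `|pi (y g s) (e g) - e g| <= eta) ->
  (forall g s i, (g <= k)%N -> (s < k)%N -> (i < s)%N -> exists c : G,
    [/\ (y g s * x i = x i * y g s * c)%g, forall j, commute c (x j)
      & `|pi c (e g) - e g| <= eta]) ->
  (forall g j, (g <= k)%N -> commute (z g) (x j)) ->
  (forall g s, (g <= k)%N -> (s < k)%N -> exists c : G,
    (y g s * x s = x s * y g s * c)%g /\ (c = z g \/ c = (z g)^-1)%g) ->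
  `|average pi [seq x i | i <- rev (iota 0 k)] (e 0)| <= lam ^+ k * W'.
Proof.
move=> lam47 uc WW' eta_small lam1 eW eS ye cx zx yx.
have lam0 : 0 < lam by move: lam47; lra.
have W0 : 0 <= W by apply: le_trans (eW 0 (leq0n _)).
have W'0 : 0 <= W' := le_trans W0 WW'.
pose u s g := average pi [seq x i | i <- rev (iota 0 s)] (e g).
have uS s g : u s.+1 g = 2^-1 *: (u s g + pi (x s) (u s g)).
  by rewrite /u -addn1 iotaD rev_cat map_cat average_cat.
have ueta s g y0 : (s < k)%N -> (g <= k)%N -> `|pi y0 (e g) - e g| <= eta ->
    (forall i, (i < s)%N -> exists c : G,
      [/\ (y0 * x i = x i * y0 * c)%g, forall j, commute c (x j)
      & `|pi c (e g) - e g| <= eta]) ->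
    `|pi y0 (u s g) - u s g| <= s.+1%:R * eta.
  move=> sk gk y0e; elim: s sk => [|s IHs] sk y0x; first by rewrite mul1r.
  have {}IHs := IHs (ltnW sk) (fun i si => y0x i (ltnW si)).
  have [c [cE cc ce]] := y0x s (ltnSn s).
  have eta0 : 0 <= eta by apply: le_trans ce.
  rewrite uS (mact_mid piP) -scalerBr opprD addrACA norm_half_add//.
    by rewrite (le_trans IHs)// ler_wpM2r// ler_nat.
  rewrite -(mactM piP) cE !(mactM piP) (mact_iso piP).
  rewrite (le_trans (ler_distD (pi y0 (u s g)) _ _))// (mact_iso piP).
  rewrite -natr1 mulrDl mul1r addrC lerD// (le_trans _ ce)//.
  by apply: (displacement_average piP) => h /mapP [i _ ->]; exact: cc.
suff H s g : (s + g <= k)%N -> `|u s g| <= lam ^+ s * W'.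
  by apply: H; rewrite addn0.
elim: s g => [|s IHs] g sgk.
  by rewrite mul1r (le_trans _ WW')// eW.
have sk : (s < k)%N by lia.
have gk : (g <= k)%N by lia.
have half : `|u s.+1 g| <= `|u s g|.
  by rewrite uS norm_half_add// rep_norm.
have [small|large] := lerP `|u s g| (16 * (k.+1%:R * eta)).
  rewrite (le_trans half)// (le_trans small)// (le_trans eta_small)//.
  by rewrite ler_wpM2r// ler_wiXn2l// ltW.
have yu : `|pi (y g s) (u s g) - u s g| <= 16^-1 * `|u s g|.
  have := ueta s g _ sk gk (ye g s gk sk) (fun i si => cx g s i gk sk si).
  have : 0 <= eta by apply: le_trans (ye g s gk sk).
  have : s.+1%:R <= k.+1%:R :> R by rewrite ler_nat; lia.
  by move: large; nra.
have [c [yxc cz]] := yx g s gk sk.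
have [contracts|grows] := heisenberg_step lam47 uc yxc cz yu.
  rewrite uS (le_trans contracts)// exprS -mulrA ler_wpM2l ?(ltW lam0)//.
  by apply: IHs; lia.
rewrite (le_trans half)// (le_trans grows)// exprS -mulrA ler_wpM2l ?(ltW lam0)//.
have -> : u s g + pi (z g) (u s g) = u s g.+1.
  rewrite /u eS; last by lia.
  rewrite averageD (mact_average piP)// => h /mapP [i _ ->].
  exact: zx.
by apply: IHs; lia.
Qed.

End Representation.
End LinearPart.

Lemma uniformly_convex_contraction (R : realType)
    (E : completeNormedModType R) : uniformly_convex E ->
  exists lam : R, [/\ 4 / 7 <= lam, lam < 1
    & forall u w : E, `|w| = `|u| -> 16^-1 * `|u| <= `|u - w| ->
        `|2^-1 *: (u + w)| <= lam * `|u|].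
Proof.
move=> [delta [delta01 deltaP]].
have e2 : 0 < (16^-1 : R) <= 2 by lra.
exists (Num.max (4 / 7) (1 - delta 16^-1)); split.
- by rewrite le_max lexx.
- by have := delta01 _ e2; rewrite gt_max; lra.
move=> u w wu uw.
have [u0|u0] := eqVneq u 0.
  have w0 : w = 0 by apply/normr0_eq0; rewrite wu u0 normr0.
  by rewrite u0 w0 addr0 scaler0 normr0 mulr0.
have nu : 0 < `|u| by rewrite normr_gt0.
have unit (v : E) : `|v| = `|u| -> `| `|u|^-1 *: v | = 1.
  by move=> vu; rewrite normrZ gtr0_norm ?invr_gt0// vu mulVf ?gt_eqF.
have := deltaP _ e2 _ _ (unit u erefl) (unit w wu).
rewrite -scalerBr -scalerDr scalerA mulrC -scalerA !(normrZ (`|u|^-1)).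
rewrite gtr0_norm ?invr_gt0// !(mulrC `|u|^-1) ler_pdivlMr// ler_pdivrMr//.
move=> /(_ uw) /le_trans; apply; rewrite ler_wpM2r//.
by rewrite le_max lexx orbT.
Qed.

(** * Monomials of the polynomial ring, graded by counting the scalar 2 *)

Section Monomials.
Variable m : nat.
Local Notation A := (mpoly m int).

(** The pair [(b, I)] stands for the monomial [2 ^ b * t ^ I]. Giving the
    scalar 2 the degree of a variable puts the coefficients and the exponents
    of a polynomial on the same footing. *)
Definition monomial := (nat * multinom m)%type.

Definition mono (M : monomial) : A := 2%:R ^+ M.1 * mpolyX int M.2.

Definition mono_deg (M : monomial) : nat := (M.1 + mdeg M.2)%N.

Definition mono_mul (M N : monomial) : monomial :=
  ((M.1 + N.1)%N, mnm_add M.2 N.2).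

Definition mono_double (b : nat) (M : monomial) : monomial := ((M.1 + b)%N, M.2).

Lemma monoM M N : mono (mono_mul M N) = mono M * mono N.
Proof. by rewrite /mono /= exprD mpolyXD mulrACA. Qed.

Lemma mono_degM M N : mono_deg (mono_mul M N) = (mono_deg M + mono_deg N)%N.
Proof. by rewrite /mono_deg /= mdegD addnACA. Qed.

Lemma mono_deg_double b M : mono_deg (mono_double b M) = (mono_deg M + b)%N.
Proof. by rewrite /mono_deg /= addnAC. Qed.

Lemma mono_double0 M : mono_double 0 M = M.
Proof. by case: M => b I; rewrite /mono_double /= addn0. Qed.

Lemma mono_doubleS b M :
  mono (mono_double b.+1 M) = mono (mono_double b M) + mono (mono_double b M).
Proof. by rewrite /mono /= addnS exprS -mulrA mulr_natl mulr2n. Qed.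

Lemma mono_mul_double b M N :
  mono_mul M (mono_double b N) = mono_double b (mono_mul M N).
Proof. by rewrite /mono_mul /mono_double /= addnA. Qed.

Lemma mono_double_inj M : injective (mono_double ^~ M).
Proof. by move=> b c [] /addnI. Qed.

Lemma mono_split d M : (d <= mono_deg M)%N ->
  exists N P, mono_mul N P = M /\ mono_deg N = d.
Proof.
elim: d => [|d IHd] dM.
  exists (0%N, mnm0), M; split; last by rewrite /mono_deg mdeg0.
  by case: M dM => b I _; rewrite /mono_mul /= add0m.
have [N [[b I] [NPM degN]]] := IHd (ltnW dM).
case: b NPM => [|b] NPM.
  have I0 : (0 < mdeg I)%N.
    by move: dM; rewrite -NPM mono_degM degN /mono_deg /=; lia.
  have [i iI] : exists i, I i != 0%N.
    apply/existsP; rewrite -negb_forall; apply/negP => /forallP I0'.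
    by move: I0; rewrite mdegE big1// => i _; exact/eqP.
  have UI : mnm_add (mnm1 i) (mnm_sub I (mnm1 i)) = I.
    apply/mnmP => j; rewrite mnmDE mnmBE mnm1E; case: eqP => [<-|_] //=.
      by rewrite subnKC// lt0n.
    by rewrite subn0.
  exists (mono_mul N (0%N, mnm1 i)), (0%N, mnm_sub I (mnm1 i)); split.
    rewrite -NPM /mono_mul /= addn0 -[in RHS]UI; congr pair.
    by apply/mnmP => j; rewrite !mnmDE addnA.
  by rewrite mono_degM degN /mono_deg /= mdeg1 add0n addn1.
exists (mono_mul N (1%N, mnm0)), (b, I); split.
  rewrite -NPM /mono_mul /= addnAC -addnA addnS addn0 addnS; congr pair.
  by apply/mnmP => j; rewrite !mnmDE mnm0E addn0.
by rewrite mono_degM degN /mono_deg /= mdeg0 addn0 addn1.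
Qed.

Definition mono_layer (d : nat) : seq monomial :=
  [seq ((d - mdeg (bmnm J))%N, bmnm J) | J <- bmnm_enum m d.+1].

Fixpoint monos (d : nat) : seq monomial :=
  if d is d'.+1 then mono_layer d' ++ monos d' else [::].

Lemma mem_mono_layer d M : (M \in mono_layer d) = (mono_deg M == d).
Proof.
apply/mapP/eqP => [[I _ ->]|<-].
  by rewrite /mono_deg /= subnK// -ltnS; case: I.
have lt : (mdeg M.2 < (mono_deg M).+1)%N by rewrite ltnS leq_addl.
exists (BMultinom lt); last by rewrite /mono_deg addnK -surjective_pairing.
by rewrite -has_pred1 has_count bmnm_enumP.
Qed.

Lemma mono_layer_uniq d : uniq (mono_layer d).
Proof.
rewrite map_inj_uniq => [|I J [_ /val_inj//]].
apply/count_mem_uniq => I; rewrite bmnm_enumP.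
by have -> : I \in bmnm_enum m d.+1 by rewrite -has_pred1 has_count bmnm_enumP.
Qed.

Lemma size_mono_layer d : (size (mono_layer d) <= d.+1 ^ m)%N.
Proof.
rewrite size_map size_pmap (leq_trans (count_size _ _))// size_map -cardE.
by rewrite card_tuple card_ord.
Qed.

Lemma mem_monos d M : (M \in monos d) = (mono_deg M < d)%N.
Proof.
elim: d => // d IHd /=; rewrite mem_cat mem_mono_layer IHd ltnS.
by rewrite [RHS]leq_eqVlt.
Qed.

Lemma monos_uniq d : uniq (monos d).
Proof.
elim: d => // d IHd /=; rewrite cat_uniq mono_layer_uniq IHd /= andbT.
apply/hasPn => M; rewrite mem_monos mem_mono_layer => Md.
by rewrite neq_ltn Md.
Qed.

Lemma size_monos d : (size (monos d) <= d * d ^ m)%N.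
Proof.
elim: d => // d IHd /=; rewrite size_cat mulSn leq_add ?size_mono_layer//.
rewrite (leq_trans IHd)// leq_mul2l; apply/orP; right.
by elim: (m) => // k IHk; rewrite !expnS leq_mul.
Qed.

Lemma size_monos_le d e : (d <= e)%N -> (size (monos d) <= size (monos e))%N.
Proof.
move=> /subnKC <-; elim: (e - d)%N => [|c IHc]; first by rewrite addn0.
by rewrite addnS /= size_cat (leq_trans IHc)// leq_addl.
Qed.

Lemma monos_extract (s : seq monomial) d : uniq s ->
  (forall M, M \in s -> mono_deg M < d)%N ->
  exists r, perm_eq (monos d) (s ++ r).
Proof.
move=> us sd; exists [seq M <- monos d | M \notin s].
apply: uniq_perm; first exact: monos_uniq.
  rewrite cat_uniq us filter_uniq ?monos_uniq// andbT.
  by apply/hasPn => M; rewrite mem_filter => /andP [].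
move=> M; rewrite mem_cat mem_filter mem_monos.
by case: (boolP (M \in s)) => [/sd ->|].
Qed.

End Monomials.

(** * Inserting and reversing inside a Heisenberg product *)

Section Additive.
Variables (V : zmodType) (G : groupType) (X : V -> G).
Hypothesis XD : forall p q, X (p + q) = (X p * X q)%g.

Lemma additive_commute p q : commute (X p) (X q).
Proof. by rewrite /commute -!XD addrC. Qed.

Lemma additiveN p : X (- p) = (X p)^-1%g.
Proof.
have X0 : X 0 = 1%g by apply: (mulgI (X 0)); rewrite -XD addr0 mulg1.
by apply: (mulgI (X p)); rewrite -XD subrr X0 mulgV.
Qed.

End Additive.

Section Heisenberg.
Variables (m : nat) (G : groupType).
Local Notation A := (mpoly m int).
Implicit Types (X Y Z : A -> G) (p q : A).

(** The sign [eps] accounts for the two orders in which a commutator of root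
    elements can be read. *)
Record heisenberg (eps : A) X Y Z : Prop := {
  heis_sign : eps = 1 \/ eps = -1;
  heisXD : forall p q, X (p + q) = (X p * X q)%g;
  heisYD : forall p q, Y (p + q) = (Y p * Y q)%g;
  heisZD : forall p q, Z (p + q) = (Z p * Z q)%g;
  heisXZ : forall p q, commute (X p) (Z q);
  heisYZ : forall p q, commute (Y p) (Z q);
  heisXY : forall p q, (X p * Y q = Y q * X p * Z (eps * (p * q))%R)%g
}.

Definition box X (d : nat) : seq G := [seq X (mono M) | M <- monos m d].

Lemma mem_box X d g : g \in box X d ->
  exists2 M, (mono_deg M < d)%N & g = X (mono M).
Proof. by move=> /mapP [M Md ->]; exists M; rewrite // -mem_monos. Qed.

Variables (R : realType) (E : normedModType R).

(** The chain [N, 2 N, 4 N, ..] inside the box is responsible: averaging over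
    it is averaging over [2 ^ t] consecutive powers. *)
Lemma box_absorbs (rho : G -> E -> E) X d t (N : monomial m) v :
  isometric_midpoint_action rho ->
  (forall p q, X (p + q) = (X p * X q)%g) -> (mono_deg N + t <= d)%N ->
  `|rho (X (mono N)) (average rho (box X d) v) - average rho (box X d) v| <=
    2 ^- t * `|rho (X (mono (mono_double t N))) v - v|.
Proof.
move=> rhoP XD Nt; set u := average rho _ v.
have Xc p q : commute (X p) (X q) by exact: additive_commute.
pose s := [seq mono_double b N | b <- iota 0 t].
have [||r sr] := @monos_extract m s d.
- by rewrite map_inj_uniq ?iota_uniq//; exact: mono_double_inj.
- by move=> M /mapP [b]; rewrite mem_iota => bt ->; rewrite mono_deg_double; lia.
have uE : u = average rho [seq X (mono M) | M <- s]
    (average rho [seq X (mono M) | M <- r] v).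
  rewrite -average_cat -map_cat; apply: average_perm => //.
    by move=> g h /mapP [? _ ->] /mapP [? _ ->].
  exact: perm_map.
rewrite uE -map_comp.
have := @displacement_dyadic_chain _ _ _ _ rhoP
  (fun b => X (mono (mono_double b N))) t
  (average rho [seq X (mono M) | M <- r] v).
rewrite /= mono_double0 => ->; last by move=> b; rewrite mono_doubleS XD.
rewrite ler_wpM2l ?invr_ge0 ?exprn_ge0//.
by apply: displacement_average => // h /mapP [M _ ->].
Qed.

(** The commutators of elements of the outer boxes have degree less than
    [a + b], and the inner box absorbs them. *)
Lemma box_reverse (rho : G -> E -> E) (eps : A) X Y Z (k a b c : nat) W v :
  isometric_midpoint_action rho -> heisenberg eps X Y Z ->
  (a + b + k <= c)%N ->
  (forall M : monomial m, (mono_deg M <= c)%N ->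
     `|rho (Z (mono M)) v - v| <= W) ->
  `|average rho (box X a) (average rho (box Z c) (average rho (box Y b) v))
    - average rho (box Y b) (average rho (box Z c) (average rho (box X a) v))|
  <= (size (monos m a))%:R * (size (monos m b))%:R * (2 ^- k * W).
Proof.
move=> rhoP H abc ZW.
have ZX p q : commute (Z p) (X q) by apply/commute_sym/(heisXZ H).
have ZY p q : commute (Z p) (Y q) by apply/commute_sym/(heisYZ H).
rewrite (average_comm rhoP (l2 := box Y b)); last first.
  by move=> g h /mem_box [M _ ->] /mem_box [N _ ->]; exact: ZY.
rewrite (average_comm rhoP (l2 := box X a)); last first.
  by move=> g h /mem_box [M _ ->] /mem_box [N _ ->]; exact: ZX.
set u := average rho (box Z c) v.
have := @average_almost_comm _ _ _ _ rhoP (box X a) (box Y b) u (2 ^- k * W).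
rewrite !size_map; apply => g h /mem_box [M Ma ->] /mem_box [N Nb ->].
exists (Z (eps * (mono M * mono N))); split; first exact: heisXY H _ _.
  by move=> h'; rewrite mem_cat => /orP [] /mem_box [P _ ->].
have -> : `|rho (Z (eps * (mono M * mono N))) u - u| =
    `|rho (Z (mono (mono_mul M N))) u - u|.
  case: (heis_sign H) => ->; rewrite monoM ?mul1r// mulN1r.
  by rewrite (additiveN (heisZD H)) (displacementV rhoP).
apply: (le_trans (@box_absorbs _ _ _ k _ _ rhoP (heisZD H) _)).
  by rewrite mono_degM; lia.
rewrite ler_wpM2l ?invr_ge0 ?exprn_ge0// ZW// mono_deg_double mono_degM.
by lia.
Qed.

Variables (rho pi : G -> E -> E) (lam : R).
Hypothesis rhoP : isometric_midpoint_action rho.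
Hypothesis piP : isometric_representation pi.
Hypothesis piB : forall g v w, pi g (v - w) = rho g v - rho g w.
Hypotheses (lam47 : 4 / 7 <= lam) (lam1 : lam <= 1).
Hypothesis contraction : forall u w : E, `|w| = `|u| ->
  16^-1 * `|u| <= `|u - w| -> `|2^-1 *: (u + w)| <= lam * `|u|.

(** Let [M] have degree [c]. Factor it as [P s * Q s] for [s < k], where the
    degree of [P s] increases by [3 k] at each step. Then [X (P s)] and
    [Y (Q s)] have the commutator [Z M], whereas for [i < s] the commutator of
    [X (P i)] and [Y (Q s)] is [Z N] with [N] of degree at most [c - 3 k], which
    the box of [Z] absorbs; also [Y (Q s)] is absorbed by the box of [Y]. So the
    difference made by [M] decays by [heisenberg_decay]. *)
Lemma box_insert_one (eps : A) X Y Z (k n a b c : nat) (M : monomial m) S W v :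
  heisenberg eps X Y Z ->
  (3 * k * k < n)%N -> (n <= a)%N -> (n <= b)%N -> (n <= c)%N ->
  (c + n <= a + b)%N -> mono_deg M = c ->
  (forall g, (g <= k)%N ->
     `|rho (Z (mono (mono_double g M))) v - v| <= W) ->
  (forall h, h \in S -> exists p, h = Z p) ->
  forall u,
  u = average rho S (average rho (box Z c) (average rho (box Y b) v)) ->
  `|average rho (box X a) (2^-1 *: (u + rho (Z (mono M)) u))
    - average rho (box X a) u| <= lam ^+ k * (32 * W).
Proof.
move=> H kn na nb nc cab degM ZW SZ u uE.
have W0 : 0 <= W by apply: le_trans (ZW 0 (leq0n _)).
have lam0 : 0 < lam by move: lam47; lra.
have Xc p q : commute (X p) (X q) by exact: (additive_commute (heisXD H)).
have Zc p q : commute (Z p) (Z q) by exact: (additive_commute (heisZD H)).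
have Yc p q : commute (Y p) (Y q) by exact: (additive_commute (heisYD H)).
have ZX p q : commute (Z p) (X q) by apply/commute_sym/(heisXZ H).
have ZY p q : commute (Z p) (Y q) by apply/commute_sym/(heisYZ H).
have SZc p h : h \in S -> commute (Z p) h by move=> /SZ [q ->].
(* The degree that has to go into [P s] for [Q s] to fit in the box of [Y]. *)
pose i0 := (c - b)%N.
have /choice [PQ PQP] : forall s, exists pq : monomial m * monomial m,
    (s < k)%N -> mono_mul pq.1 pq.2 = M /\
                 mono_deg pq.1 = (i0 + 3 * k * s.+1)%N.
  move=> s; case: (ltnP s k) => [sk|]; last by exists (M, M).
  have [|N [P [NP Nd]]] := @mono_split m (i0 + 3 * k * s.+1) M.
    have : (3 * k * s.+1 <= 3 * k * k)%N by rewrite leq_mul.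
    by rewrite degM /i0; lia.
  by exists (N, P).
have Pdeg s : (s < k)%N -> (mono_deg (PQ s).1 < a)%N.
  move=> sk; rewrite (PQP s sk).2.
  have : (3 * k * s.+1 <= 3 * k * k)%N by rewrite leq_mul.
  by rewrite /i0; lia.
have Qdeg s : (s < k)%N ->
    (mono_deg (PQ s).2 + (i0 + 3 * k * s.+1) = c)%N.
  move=> sk; have [QM Qd] := PQP s sk.
  by have := mono_degM (PQ s).1 (PQ s).2; rewrite QM Qd degM; lia.
pose x s := X (mono (PQ s).1).
pose y g s := Y (mono (mono_double g (PQ s).2)).
pose z g := Z (mono (mono_double g M)).
pose T d := average pi S (average pi (box Z c) (average pi (box Y b) d)).
pose d g := rho (z g) v - v.
pose e g := T (d g).
have TD d1 d2 : T (d1 + d2) = T d1 + T d2 by rewrite /T !(averageD piP).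
have T_norm d1 : `|T d1| <= `|d1|.
  by rewrite /T !(le_trans (average_norm piP _ _)).
have ZT p d1 : pi (Z p) (T d1) = T (pi (Z p) d1).
  rewrite /T !(mact_average piP)// => h;
    by [exact: SZc | move=> /mem_box [N _ ->]; by [exact: Zc | exact: ZY]].
have diff : rho (z 0) u - u = e 0.
  rewrite /e /T /d !(average_linear_part _ _ _ piB) uE.
  rewrite !(mact_average rhoP)// => h;
    by [exact: SZc | move=> /mem_box [N _ ->]; by [exact: Zc | exact: ZY]].
pose s0 := [seq (PQ i).1 | i <- rev (iota 0 k)].
have [||r rP] := @monos_extract m s0 a.
- rewrite map_inj_in_uniq ?rev_uniq ?iota_uniq// => i j.
  rewrite !mem_rev !mem_iota !add0n /= => ik jk PQij.
  have := (PQP i ik).2; rewrite PQij (PQP j jk).2; clear -ik; nia.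
- by move=> N /mapP [i]; rewrite mem_rev mem_iota => ik ->; exact: Pdeg.
rewrite (average_mid rhoP) -[X in _ - X]half_addrr -scalerBr opprD addrACA.
rewrite subrr add0r normrZ ger0_norm ?invr_ge0//.
rewrite -(average_linear_part _ _ _ piB).
rewrite -[Z (mono M)]/(Z (mono M)) -{1}(mono_double0 M) -/(z 0) diff.
have -> : average pi (box X a) (e 0) = average pi
    ([seq X (mono N) | N <- r] ++ [seq X (mono N) | N <- s0]) (e 0).
  apply: (average_perm piP) => [g h|].
    by move=> /mem_box [? _ ->] /mem_box [? _ ->]; exact: Xc.
  by rewrite -map_cat; apply/perm_map/(perm_trans rP); rewrite perm_catC.
rewrite average_cat.
apply: (@le_trans _ _ `|average pi [seq X (mono N) | N <- s0] (e 0)|).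
  have := average_norm piP [seq X (mono N) | N <- r]
    (average pi [seq X (mono N) | N <- s0] (e 0)).
  by rewrite ler_pdivrMl//; move=> /le_trans; apply; rewrite ler_peMl// ler1n.
rewrite /s0 -map_comp.
have dW g : (g <= k)%N -> `|d g| <= W by exact: ZW.
have ZN g N : (g <= k)%N -> (mono_deg N + 2 * k <= c)%N ->
    `|pi (Z (mono N)) (e g) - e g| <= 2 ^- (2 * k) * (2 * W).
  move=> gk Nc.
  rewrite /e /T; apply: (le_trans (displacement_average piP _ _)).
    by move=> h; exact: SZc.
  apply: (le_trans (box_absorbs _ piP (heisZD H) Nc)).
  rewrite ler_wpM2l ?invr_ge0 ?exprn_ge0//.
  apply: (le_trans (ler_normB _ _)).
  rewrite (rep_norm piP).
  by have := le_trans (average_norm piP (box Y b) (d g)) (dW g gk); lra.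
have sgnE r0 u0 : `|pi (Z (eps * r0)) u0 - u0| = `|pi (Z r0) u0 - u0|.
  case: (heis_sign H) => ->; rewrite ?mul1r// mulN1r.
  by rewrite (additiveN (heisZD H)) (displacementV piP).
have yxc p q : (Y q * X p = X p * Y q * (Z (eps * (p * q))%R)^-1)%g.
  by rewrite (heisXY H) mulgK.
apply: (@heisenberg_decay _ _ _ _ piP lam W (32 * W)
  (2 ^- (2 * k) * (2 * W)) k x z y e) => //.
- lra.
- have k2 : k.+1%:R <= 2 ^+ k :> R.
    by rewrite -natrX ler_nat ltn_expl.
  have -> : 16 * (k.+1%:R * (2 ^- (2 * k) * (2 * W))) =
      k.+1%:R * 2 ^- (2 * k) * (32 * W) by ring.
  rewrite ler_wpM2r ?mulr_ge0// mulnC muln2 -addnn exprD invfM mulrA.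
  apply: (@le_trans _ _ (2 ^- k)).
    rewrite ler_piMl ?invr_ge0 ?exprn_ge0//.
    by rewrite ler_pdivrMr ?exprn_gt0// mul1r.
  rewrite -exprVn lerXn2r ?nnegrE ?invr_ge0 ?ltW//.
  by move: lam47; lra.
- by move=> g gk; rewrite (le_trans (T_norm _))// dW.
- move=> g gk; rewrite /e ZT -TD; congr T.
  rewrite /d piB -(mactM rhoP) -(heisZD H) -mono_doubleS -/(z g.+1).
  by rewrite [RHS]addrC subrKA.
- move=> g s gk sk.
  have Nb : (mono_deg (mono_double g (PQ s).2) + 2 * k <= b)%N.
    have := Qdeg s sk; have : (3 * k <= 3 * k * s.+1)%N by rewrite leq_pmulr.
    by rewrite mono_deg_double /i0; lia.
  rewrite /e /T; apply: (le_trans (displacement_average piP _ _)).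
    by move=> h /SZ [p ->]; exact: heisYZ H _ _.
  apply: (le_trans (displacement_average piP _ _)).
    by move=> h /mem_box [N _ ->]; exact: heisYZ H _ _.
  apply: (le_trans (box_absorbs _ piP (heisYD H) Nb)).
  rewrite ler_wpM2l ?invr_ge0 ?exprn_ge0//.
  apply: (le_trans (ler_normB _ _)).
  by rewrite (rep_norm piP); have := dW g gk; lra.
- move=> g s i gk sk si; exists (Z (eps * mono (mono_mul (PQ i).1
    (mono_double g (PQ s).2)))%R)^-1%g; split.
  + by rewrite yxc monoM.
  + by move=> j; exact/commute_sym/commuteV/commute_sym/ZX.
  rewrite (displacementV piP) sgnE; apply: ZN => //.
  rewrite mono_degM mono_deg_double (PQP i (ltn_trans si sk)).2.
  have := Qdeg s sk.
  have : (3 * k * i.+2 <= 3 * k * s.+1)%N by rewrite leq_mul.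
  by lia.
- by move=> g j _; exact: ZX.
- move=> g s gk sk; exists (Z (eps * mono (mono_double g M))%R)^-1%g; split.
    by rewrite yxc -monoM mono_mul_double (PQP s sk).1.
  rewrite /z; case: (heis_sign H) => ->; first by right; rewrite mul1r.
  by left; rewrite mulN1r (additiveN (heisZD H)) invgK.
Qed.

(** The monomials of degrees [c] up to [c' - 1] are inserted one by one, in the
    order of their degrees, so that each finds all smaller degrees present. *)
Lemma box_insert (eps : A) X Y Z (k n a b c c' : nat) W v :
  heisenberg eps X Y Z ->
  (3 * k * k < n)%N -> (n <= a)%N -> (n <= b)%N -> (n <= c)%N ->
  (c <= c')%N -> (c' + n <= a + b)%N ->
  (forall M : monomial m, (mono_deg M <= c' + k)%N ->
     `|rho (Z (mono M)) v - v| <= W) ->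
  `|average rho (box X a) (average rho (box Z c) (average rho (box Y b) v))
    - average rho (box X a) (average rho (box Z c') (average rho (box Y b) v))|
  <= (size (monos m c'))%:R * (lam ^+ k * (32 * W)).
Proof.
move=> H kn na nb nc cc'; set u := average rho (box Y b) v.
have -> : c' = (c + (c' - c))%N by rewrite subnKC.
elim: (c' - c)%N => [|d IHd] cab ZW.
  rewrite addn0 in ZW *; rewrite subrr normr0 !mulr_ge0 ?exprn_ge0//.
    by move: lam47; lra.
  by apply: le_trans (ZW (0%N, mnm0) _); rewrite /mono_deg ?mdeg0.
have cd : (c + d + n <= a + b)%N by lia.
have {}IHd := IHd cd (fun M Mc => ZW M (leq_trans Mc _)).
set w := average rho (box Z (c + d)) u.
have layer l : (forall M : monomial m, M \in l -> mono_deg M = (c + d)%N) ->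
    `|average rho (box X a) (average rho [seq Z (mono M) | M <- l] w)
      - average rho (box X a) w| <= (size l)%:R * (lam ^+ k * (32 * W)).
  elim: l => [|M l IHl] lc; first by rewrite subrr normr0 mul0r.
  have {}IHl := IHl (fun N Nl => lc N (mem_behead (s := M :: l) Nl)).
  rewrite [size _]/= -[(size l).+1]add1n natrD mulrDl mul1r.
  apply: (le_trans (ler_distD (average rho (box X a)
    (average rho [seq Z (mono M) | M <- l] w)) _ _)); apply: lerD => //.
  apply: (@box_insert_one eps X Y Z k n a b (c + d) M
    [seq Z (mono N) | N <- l] W v) => //; first by lia.
  - by apply: lc; exact: mem_head.
  - move=> g gk; apply: ZW.
    by rewrite mono_deg_double lc ?mem_head//; lia.
  - by move=> h /mapP [N _ ->]; exists (mono N).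
rewrite addnS /box /= map_cat average_cat size_cat natrD mulrDl [leRHS]addrC.
apply: (le_trans (ler_distD (average rho (box X a) w) _ _)).
apply: lerD; first by apply: IHd; lia.
rewrite distrC; apply: layer => M.
by rewrite mem_mono_layer => /eqP.
Qed.

End Heisenberg.

(** * Root elements of the Steinberg group *)

Section RootElements.
Variable A : comNzRingType.
Implicit Types (a b c : 'I_3) (p q : A).

(** Total in the pair [(a, b)], so that no proof of [a != b] is carried
    around. *)
Definition root_elt a b p : steinberg_group A :=
  if insub (a, b) is Some alpha then steinberg_gen alpha p else 1%g.

Lemma root_eltE a b (ab : a != b) p :
  root_elt a b p = steinberg_gen (exist _ (a, b) ab) p.
Proof. by rewrite /root_elt insubT. Qed.

Lemma root_elt_diag a p : root_elt a a p = 1%g.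
Proof. by rewrite /root_elt insubF//= eqxx. Qed.

Lemma root_eltD a b p q :
  root_elt a b (p + q) = (root_elt a b p * root_elt a b q)%g.
Proof.
rewrite /root_elt; case: insubP => [alpha _ _|_]; last by rewrite mulg1.
exact: steinberg_genD.
Qed.

Lemma presented_class_mul (X : choiceType) (rels : word X -> word X -> Prop)
    (u v : word X) :
  (presented_class rels u * presented_class rels v)%g =
  presented_class rels (u ++ v).
Proof. exact: presented_mulE. Qed.

Lemma presented_class_inv (X : choiceType) (rels : word X -> word X -> Prop)
    (u : word X) :
  (presented_class rels u)^-1%g = presented_class rels (word_inv u).
Proof. exact: presented_invE. Qed.

Lemma presented_class_comm (X : choiceType) (rels : word X -> word X -> Prop)
    (u v w : word X) (x := presented_class rels u)
    (y := presented_class rels v) (z := presented_class rels w) :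
  rels (word_comm u v) w -> (x * y = z * (y * x))%g.
Proof.
move=> /presented_eq_rel /presented_classP; rewrite /word_comm.
rewrite -!presented_class_mul -!presented_class_inv -/x -/y -/z => <-.
by rewrite !mulgA mulgVK mulgVK.
Qed.

Lemma root_elt_row a b c p q : a != b -> a != c ->
  commute (root_elt a b p) (root_elt a c q).
Proof.
move=> ab ac; have [<-|bc] := eqVneq b c.
  exact: (additive_commute (root_eltD a b)).
rewrite !root_eltE /commute (presented_class_comm (w := [::]) _) ?mul1g//.
exact: steinberg_row.
Qed.

Lemma root_elt_col a b c p q : b != a -> c != a ->
  commute (root_elt b a p) (root_elt c a q).
Proof.
move=> ba ca; have [<-|bc] := eqVneq b c.
  exact: (additive_commute (root_eltD b a)).
rewrite !root_eltE /commute (presented_class_comm (w := [::]) _) ?mul1g//.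
exact: steinberg_col.
Qed.

Lemma root_elt_comm a b c p q : a != b -> b != c -> a != c ->
  (root_elt a b p * root_elt b c q =
   root_elt a c (p * q) * (root_elt b c q * root_elt a b p))%g.
Proof.
move=> ab bc ac; rewrite !root_eltE.
by apply: presented_class_comm; exact: steinberg_comm.
Qed.

End RootElements.

Section RootHeisenberg.
Variable m : nat.
Local Notation A := (mpoly m int).
Local Notation x := (@root_elt A).

Lemma root_heisenberg a b c : a != b -> b != c -> a != c ->
  heisenberg 1 (x a b) (x b c) (x a c).
Proof.
move=> ab bc ac.
have xz p q : commute (x a b p) (x a c q) by exact: root_elt_row.
have yz p q : commute (x b c p) (x a c q) by exact: root_elt_col.
split; rewrite ?mul1r => //; try exact: root_eltD; first by left.
move=> p q; by rewrite mul1r root_elt_comm// mulgA -yz -!mulgA -xz.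
Qed.

Lemma root_heisenberg_opp a b c : a != b -> b != c -> a != c ->
  heisenberg (-1) (x b c) (x a b) (x a c).
Proof.
move=> ab bc ac; have [_ _ _ _ xz yz xy] := root_heisenberg ab bc ac.
split; try exact: root_eltD; [by right|exact: yz|exact: xz|].
move=> p q; rewrite xy mul1r mulN1r additiveN; last exact: root_eltD.
by rewrite [p * q]mulrC mulgK.
Qed.

End RootHeisenberg.

(** * Lengths of root elements *)

Section Length.
Variables (m : nat) (R : realType) (E : normedModType R).
Local Notation A := (mpoly m int).
Local Notation x := (@root_elt A).
Variable rho : steinberg_group A -> E -> E.
Hypothesis rhoP : isometric_midpoint_action rho.
Implicit Types (a b c : 'I_3) (M : monomial m).

Lemma third_index a b : exists c : 'I_3, (c != a) && (c != b).
Proof.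
apply/existsP; move: a b.
by case=> [[|[|[|?]]] // ?]; case=> [[|[|[|?]]] // ?]; apply/existsP;
  [exists (inord 1)|exists (inord 2)|exists (inord 1)|exists (inord 2)
  |exists (inord 0)|exists (inord 0)|exists (inord 1)|exists (inord 0)
  |exists (inord 0)]; rewrite -!val_eqE /= !inordK.
Qed.

(** A monomial of degree at most [2 ^ j.+1] is a product of two of degree at
    most [2 ^ j], so that its root element is a commutator, a product of four
    root elements of these degrees or their inverses. *)
Lemma root_displacement_pow v : exists2 C : R, 0 <= C &
  forall j a b M, (mono_deg M <= 2 ^ j)%N ->
    `|rho (x a b (mono M)) v - v| <= C * 4 ^+ j.
Proof.
have bounded (T : eqType) (f : T -> R) (s : seq T) :
    exists2 C, 0 <= C & forall t, t \in s -> f t <= C.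
  elim: s => [|t s [C C0 sC]]; first by exists 0.
  exists (Num.max C (f t)); first by rewrite le_max C0.
  move=> u; rewrite in_cons => /orP [/eqP ->|/sC uC]; rewrite le_max.
    by rewrite lexx orbT.
  by rewrite uC.
pose f (abM : 'I_3 * 'I_3 * monomial m) :=
  `|rho (x abM.1.1 abM.1.2 (mono abM.2)) v - v|.
have [C C0 fC] := bounded _ f
  [seq (ab, M) | ab <- enum {: 'I_3 * 'I_3}, M <- monos m 2].
exists C => //; elim=> [|j IHj] a b M Mj.
  rewrite mulr1; apply: (fC (a, b, M)); apply/allpairsP.
  by exists ((a, b), M); rewrite mem_enum mem_monos.
have [<-|ab] := eqVneq a b.
  by rewrite root_elt_diag (mact1 rhoP) subrr normr0 mulr_ge0 ?exprn_ge0.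
have [c /andP [ca cb]] := third_index a b.
have [N [P [<- Nj Pj]]] : exists N P, [/\ mono_mul N P = M,
    (mono_deg N <= 2 ^ j)%N & (mono_deg P <= 2 ^ j)%N].
  have [|N [P [NP dN]]] := @mono_split m (minn (mono_deg M) (2 ^ j)) M.
    exact: geq_minl.
  exists N, P; rewrite NP dN; split => //; first exact: geq_minr.
  have := mono_degM N P; rewrite NP dN.
  by move: Mj; rewrite expnS; set q := (2 ^ j)%N; clearbody q; lia.
have ac : a != c by rewrite eq_sym.
have xyz := heisXY (@root_heisenberg m a c b ac cb ab) (mono N) (mono P).
rewrite mul1r -monoM in xyz.
have -> : x a b (mono (mono_mul N P)) = ((x a c (mono N))^-1 *
    ((x c b (mono P))^-1 * (x a c (mono N) * x c b (mono P))))%g.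
  by rewrite xyz -!mulgA !mulKg.
have dN := IHj a c N Nj; have dP := IHj c b P Pj.
have := displacementM rhoP (x a c (mono N))^-1%g
  ((x c b (mono P))^-1 * (x a c (mono N) * x c b (mono P)))%g v.
have := displacementM rhoP (x c b (mono P))^-1%g
  (x a c (mono N) * x c b (mono P))%g v.
have := displacementM rhoP (x a c (mono N)) (x c b (mono P)) v.
rewrite !(displacementV rhoP) exprS; lra.
Qed.

Lemma root_displacement v : exists2 C : R, 0 <= C &
  forall d a b M, (0 < d)%N -> (mono_deg M <= d)%N ->
    `|rho (x a b (mono M)) v - v| <= C * (d * d)%:R.
Proof.
have [C C0 HC] := root_displacement_pow v.
exists (C * 4) => [|d a b M d0 Md]; first by rewrite mulr_ge0.
have [dle dlt] : (2 ^ trunc_log 2 d <= d /\ d < 2 ^ (trunc_log 2 d).+1)%N.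
  by have /andP [] := trunc_log_bounds (isT : (1 < 2)%N) d0.
apply: le_trans (HC (trunc_log 2 d).+1 a b M (leq_trans Md (ltnW dlt))) _.
rewrite -mulrA ler_wpM2l// exprS ler_wpM2l//.
have -> : 4 = (2 * 2)%:R :> R by [].
by rewrite -natrX ler_nat expnMn leq_mul.
Qed.

End Length.

(** * Words of boxes *)

Section Words.
Variables (m : nat) (R : realType) (E : normedModType R).
Local Notation A := (mpoly m int).
Local Notation G := (steinberg_group A).
Local Notation x := (@root_elt A).
Variables (rho pi : G -> E -> E) (lam : R).
Hypothesis rhoP : isometric_midpoint_action rho.
Hypothesis piP : isometric_representation pi.
Hypothesis piB : forall g v w, pi g (v - w) = rho g v - rho g w.
Hypotheses (lam47 : 4 / 7 <= lam) (lam1 : lam <= 1).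
Hypothesis contraction : forall u w : E, `|w| = `|u| ->
  16^-1 * `|u| <= `|u - w| -> `|2^-1 *: (u + w)| <= lam * `|u|.
Variable v : E.
Implicit Types (a b c : nat) (r s t : 'I_3 * 'I_3) (w : seq ('I_3 * 'I_3 * nat)).

(** The letter [(r, a)] averages over the root elements of [r] at all
    monomials of degree less than [a]. *)
Definition walk w (u : E) : E :=
  foldr (fun l => average rho (box (x l.1.1 l.1.2) l.2)) u w.

Lemma walk_cat w1 w2 u : walk (w1 ++ w2) u = walk w1 (walk w2 u).
Proof. exact: foldr_cat. Qed.

Lemma walk_dist w u1 u2 : `|walk w u1 - walk w u2| <= `|u1 - u2|.
Proof.
elim: w => //= l w IHw; apply: le_trans IHw.
exact: average_dist rhoP _ _ _.
Qed.

(** [D] bounds the degrees in play and [L] the displacement of [v] by root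
    elements of these degrees. *)
Variables (D : nat) (L : R).
Hypothesis L_displacement : forall i j (M : monomial m), (mono_deg M <= D)%N ->
  `|rho (x i j (mono M)) v - v| <= L.

Let S : R := (size (monos m D))%:R.
Let W : R := L * (1 + 12 * S).

Let L_ge0 : 0 <= L.
Proof.
have := L_displacement (M := (0%N, mnm0)) ord0 ord0.
by rewrite /mono_deg mdeg0 => /(_ isT); apply: le_trans.
Qed.

Let lam_ge0 : 0 <= lam.
Proof. by move: lam47; lra. Qed.

Let W_ge0 : 0 <= W.
Proof. by rewrite mulr_ge0// addr_ge0// mulr_ge0. Qed.

Lemma walk_displacement w i j (M : monomial m) :
  (size w <= 6)%N -> all (fun l => l.2 <= D)%N w -> (mono_deg M <= D)%N ->
  `|rho (x i j (mono M)) (walk w v) - walk w v| <= W.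
Proof.
move=> w6 wD MD.
have L0 := L_ge0.
have S0 : 0 <= S by exact: ler0n.
have dist : `|walk w v - v| <= (size w)%:R * (S * L).
  elim: w wD {w6} => [|l w IHw] /= => [_|/andP [lD wD]].
    by rewrite subrr normr0 mul0r.
  rewrite -[(size w).+1]add1n natrD mulrDl mul1r [leRHS]addrC.
  set B := average rho (box (x l.1.1 l.1.2) l.2).
  apply: (le_trans (ler_distD (B v) _ _)); apply: lerD.
    exact: le_trans (average_dist rhoP _ _ _) (IHw wD).
  apply: (le_trans (average_displacement (B := L) rhoP _)).
    move=> g /mem_box [N Nl ->]; apply: L_displacement.
    exact: leq_trans (ltnW Nl) lD.
  rewrite size_map ler_wpM2r// ler_nat.
  exact: size_monos_le.
have := displacement_dist rhoP (x i j (mono M)) v (walk w v).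
have := L_displacement i j MD.
have : (size w)%:R <= 6 :> R by rewrite ler_nat.
have : 0 <= S * L by rewrite mulr_ge0.
rewrite /W; nra.
Qed.

Definition close k w1 w2 : Prop :=
  `|walk w1 v - walk w2 v| <= S * S * (lam ^+ k * (32 * W)).

Lemma close_sym k w1 w2 : close k w1 w2 -> close k w2 w1.
Proof. by rewrite /close distrC. Qed.

Let root_box r : A -> G := x r.1 r.2.

Lemma close_insert (eps : A) k n w1 w2 r s t a b c c' :
  heisenberg eps (root_box r) (root_box t) (root_box s) ->
  (3 * k * k < n)%N -> [&& n <= a, n <= b, n <= c & n <= c']%N ->
  (maxn c c' + n <= a + b)%N -> (maxn c c' + k <= D)%N ->
  (size w2 <= 6)%N -> all (fun l => l.2 <= D)%N w2 ->
  close k (w1 ++ [:: (r, a); (s, c); (t, b)] ++ w2)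
          (w1 ++ [:: (r, a); (s, c'); (t, b)] ++ w2).
Proof.
move=> H kn; wlog cc' : c c' / (c <= c')%N => [wl|].
  move=> /and4P [na nb nc nc'] cab ck w6 wD.
  have [cc'|/ltnW cc'] := leqP c c'; first by apply: wl => //; apply/and4P.
  by apply/close_sym/wl; rewrite // 1?maxnC//; apply/and4P.
rewrite (maxn_idPr cc') => /and4P [na nb nc nc'] cab ck w6 wD.
rewrite /close !walk_cat; apply: (le_trans (walk_dist _ _ _)) => /=.
apply: (le_trans (box_insert (k := k) (n := n) (W := W) rhoP piP piB lam47 lam1
  contraction H kn na nb nc cc' cab _)).
  move=> M Mc; apply: walk_displacement => //.
  exact: leq_trans Mc ck.
have S1 : 1 <= S.
  rewrite ler1n; have : (0%N, mnm0) \in monos m D.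
    by rewrite mem_monos /mono_deg /= mdeg0; lia.
  by case: (monos m D).
apply: ler_pM => //.
  by apply: mulr_ge0; [exact: exprn_ge0|rewrite mulr_ge0 ?W_ge0].
apply: (@le_trans _ _ S); last by rewrite ler_peMl// ler0n.
by rewrite ler_nat size_monos_le//; lia.
Qed.

Lemma close_reverse (eps : A) k w1 w2 r s t a b c :
  heisenberg eps (root_box r) (root_box t) (root_box s) ->
  (a + b + k <= c)%N -> (c <= D)%N ->
  (size w2 <= 6)%N -> all (fun l => l.2 <= D)%N w2 ->
  close k (w1 ++ [:: (r, a); (s, c); (t, b)] ++ w2)
          (w1 ++ [:: (t, b); (s, c); (r, a)] ++ w2).
Proof.
move=> H abc cD w6 wD.
rewrite /close !walk_cat; apply: (le_trans (walk_dist _ _ _)) => /=.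
apply: (le_trans (box_reverse (k := k) (W := W) rhoP H abc _)).
  move=> M Mc; apply: walk_displacement => //.
  exact: leq_trans Mc cD.
apply: ler_pM.
- by rewrite mulr_ge0.
- by rewrite mulr_ge0 ?invr_ge0 ?exprn_ge0 ?W_ge0.
- by rewrite ler_pM// ler_nat size_monos_le//; lia.
rewrite mulrA; apply: ler_pM; rewrite ?W_ge0 ?invr_ge0 ?exprn_ge0//.
have : 2 ^- k <= lam ^+ k.
  by rewrite -exprVn lerXn2r ?nnegrE ?invr_ge0//; move: lam47; lra.
by have := exprn_ge0 k lam_ge0; lra.
Qed.

Ltac nat_lia :=
  repeat match goal with
  | H : ?T |- _ =>
    lazymatch T with is_true (leq _ _) => fail | nat => fail | _ => clear H end
  end; lia.

Section Hexagon.
Variables (i j l : 'I_3).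
Hypotheses (ij : i != j) (jl : j != l) (il : i != l).

(** The six roots in the cyclic order in which each is the sum of its two
    neighbours, cut open between [(l, j)] and [(i, j)]. The sizes are such that
    both halves can be reversed: then [(i, j)] and [(l, j)], which were at the
    ends, are surrounded by their neighbours. *)
Definition hexagon n : seq ('I_3 * 'I_3 * nat) :=
  [:: (i, j, n); (i, l, 5 * n); (j, l, 3 * n);
      (j, i, 3 * n); (l, i, 5 * n); (l, j, n)]%N.

Lemma hexagon_step k n n' :
  (3 * k * k < n)%N -> (2 * k <= n)%N -> (n <= n')%N -> (2 * n' <= 3 * n)%N ->
  (n' + k <= 2 * n)%N -> (8 * n <= D)%N ->
  `|walk (hexagon n) v - walk (hexagon n') v| <=
    12 * (S * S * (lam ^+ k * (32 * W))).
Proof.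
move=> kn k2n nn' n'3 n'k nD.
have ji : j != i by rewrite eq_sym.
have lj : l != j by rewrite eq_sym.
have li : l != i by rewrite eq_sym.
have h13 := @root_heisenberg m _ _ _ ij jl il.
have h21 := @root_heisenberg m _ _ _ jl li ji.
have h12 := @root_heisenberg m _ _ _ il lj ij.
have h23 := @root_heisenberg_opp m _ _ _ ji il jl.
have h31 := @root_heisenberg_opp m _ _ _ lj ji li.
have h32 := @root_heisenberg_opp m _ _ _ li ij lj.
pose w (a12 a13 a23 a21 a31 a32 : nat) :=
  [:: (i, j, a12); (i, l, a13); (j, l, a23);
      (j, i, a21); (l, i, a31); (l, j, a32)].
pose w' (a12 a13 a23 a21 a31 a32 : nat) :=
  [:: (j, l, a23); (i, l, a13); (i, j, a12);
      (l, j, a32); (l, i, a31); (j, i, a21)].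
have flip a12 a13 a23 a21 a31 a32 :
    (a12 + a23 + k <= a13)%N -> (a21 + a32 + k <= a31)%N ->
    (a13 <= D)%N -> (a31 <= D)%N ->
    `|walk (w a12 a13 a23 a21 a31 a32) v - walk (w' a12 a13 a23 a21 a31 a32) v|
      <= 2 * (S * S * (lam ^+ k * (32 * W))).
  move=> a1 a3 D1 D3.
  pose w1 := [:: (j, l, a23); (i, l, a13); (i, j, a12);
      (j, i, a21); (l, i, a31); (l, j, a32)].
  have c1 : close k (w a12 a13 a23 a21 a31 a32) w1.
    by apply: (close_reverse [::] (r := (i, j)) (s := (i, l)) (t := (j, l))
      h13) => //=; nat_lia.
  have c2 : close k w1 (w' a12 a13 a23 a21 a31 a32).
    by apply: (close_reverse [:: (j, l, a23); (i, l, a13); (i, j, a12)]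
      (w2 := [::]) (r := (j, i)) (s := (l, i)) (t := (l, j)) h31) => //=; nat_lia.
  have := ler_distD (walk w1 v) (walk (w a12 a13 a23 a21 a31 a32) v)
    (walk (w' a12 a13 a23 a21 a31 a32) v).
  by move: c1 c2; rewrite /close; lra.
have c1 := flip n (5 * n)%N (3 * n)%N (3 * n)%N (5 * n)%N n
  ltac:(nat_lia) ltac:(nat_lia) ltac:(nat_lia) ltac:(nat_lia).
have c2 : close k (w' n (5 * n) (3 * n) (3 * n) (5 * n) n)%N
    (w' n' (5 * n) (3 * n) (3 * n) (5 * n) n)%N.
  by apply: (close_insert (n := n) [:: (j, l, 3 * n)%N] (r := (i, l))
    (s := (i, j)) (t := (l, j)) h12) => //=; nat_lia.
have c3 : close k (w' n' (5 * n) (3 * n) (3 * n) (5 * n) n)%N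
    (w' n' (5 * n) (3 * n) (3 * n) (5 * n) n')%N.
  by apply: (close_insert (n := n) [:: (j, l, 3 * n)%N; (i, l, 5 * n)%N]
    (r := (i, j)) (s := (l, j)) (t := (l, i)) h32) => //=; nat_lia.
have c4 := flip n' (5 * n)%N (3 * n)%N (3 * n)%N (5 * n)%N n'
  ltac:(nat_lia) ltac:(nat_lia) ltac:(nat_lia) ltac:(nat_lia).
(* The two roots in the middle are enlarged for the time during which their
   neighbours [(i, l)] and [(l, i)] grow. *)
have c5 : close k (w n' (5 * n) (3 * n) (3 * n) (5 * n) n')%N
    (w n' (5 * n) (7 * n) (3 * n) (5 * n) n')%N.
  by apply: (close_insert (n := n) [:: (i, j, n')] (r := (i, l))
    (s := (j, l)) (t := (j, i)) h23) => //=; nat_lia.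
have c6 : close k (w n' (5 * n) (7 * n) (3 * n) (5 * n) n')%N
    (w n' (5 * n) (7 * n) (7 * n) (5 * n) n')%N.
  by apply: (close_insert (n := n) [:: (i, j, n'); (i, l, 5 * n)%N]
    (r := (j, l)) (s := (j, i)) (t := (l, i)) h21) => //=; nat_lia.
have c7 : close k (w n' (5 * n) (7 * n) (7 * n) (5 * n) n')%N
    (w n' (5 * n') (7 * n) (7 * n) (5 * n) n')%N.
  by apply: (close_insert (n := n) [::]
    (r := (i, j)) (s := (i, l)) (t := (j, l)) h13) => //=; nat_lia.
have c8 : close k (w n' (5 * n') (7 * n) (7 * n) (5 * n) n')%N
    (w n' (5 * n') (7 * n) (7 * n) (5 * n') n')%N.
  by apply: (close_insert (n := n)
    [:: (i, j, n'); (i, l, 5 * n')%N; (j, l, 7 * n)%N] (w2 := [::])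
    (r := (j, i)) (s := (l, i)) (t := (l, j)) h31) => //=; nat_lia.
have c9 : close k (w n' (5 * n') (7 * n) (7 * n) (5 * n') n')%N
    (w n' (5 * n') (3 * n') (7 * n) (5 * n') n')%N.
  by apply: (close_insert (n := n) [:: (i, j, n')] (r := (i, l))
    (s := (j, l)) (t := (j, i)) h23) => //=; nat_lia.
have c10 : close k (w n' (5 * n') (3 * n') (7 * n) (5 * n') n')%N
    (w n' (5 * n') (3 * n') (3 * n') (5 * n') n')%N.
  by apply: (close_insert (n := n) [:: (i, j, n'); (i, l, 5 * n')%N]
    (r := (j, l)) (s := (j, i)) (t := (l, i)) h21) => //=; nat_lia.
rewrite distrC in c4.
move: c1 c2 c3 c4 c5 c6 c7 c8 c9 c10; rewrite /close.
rewrite -/(hexagon n) -/(hexagon n').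
set e := S * S * _ => c1 c2 c3 c4 c5 c6 c7 c8 c9 c10.
have tri (u1 u2 u3 : E) (e1 e2 : R) : `|u1 - u2| <= e1 -> `|u2 - u3| <= e2 ->
    `|u1 - u3| <= e1 + e2.
  by move=> d1 d2; rewrite (le_trans (ler_distD u2 _ _))// lerD.
have := tri _ _ _ _ _ c9 c10; move=> /(tri _ _ _ _ _ c8) /(tri _ _ _ _ _ c7).
move=> /(tri _ _ _ _ _ c6) /(tri _ _ _ _ _ c5) /(tri _ _ _ _ _ c4).
move=> /(tri _ _ _ _ _ c3) /(tri _ _ _ _ _ c2) /(tri _ _ _ _ _ c1).
by move=> /le_trans; apply; clearbody e; lra.
Qed.

Lemma hexagon_displacement k n (M : monomial m) :
  (mono_deg M + k <= 5 * n)%N -> (5 * n <= D)%N -> (0 < n)%N ->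
  `|rho (x i l (mono M)) (walk (hexagon n) v) - walk (hexagon n) v| <=
    2 ^- k * W.
Proof.
move=> Mk nD n0 /=.
apply: (le_trans (displacement_average rhoP _ _)).
  by move=> h /mem_box [N _ ->]; apply: root_elt_row.
apply: (le_trans (box_absorbs _ rhoP (@root_eltD _ i l) Mk)).
rewrite ler_wpM2l ?invr_ge0 ?exprn_ge0//.
apply: (walk_displacement (w := [:: (j, l, 3 * n); (j, i, 3 * n);
  (l, i, 5 * n); (l, j, n)]%N)) => //=; first by nat_lia.
by rewrite mono_deg_double; nat_lia.
Qed.

End Hexagon.
End Words.

(** * Subexponential growth *)

Section Subexponential.
Variable R : realType.
Implicit Types (f g : nat -> R).

Definition subexponential f : Prop :=
  (forall k, 0 <= f k) /\
  forall t, 1 < t -> exists C, forall k, f k <= C * t ^+ k.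

Lemma subexponential_le f g : (forall k, 0 <= f k <= g k) ->
  subexponential g -> subexponential f.
Proof.
move=> fg [_ gC]; split=> [k|t t1]; first by have /andP [] := fg k.
have [C gCk] := gC t t1; exists C => k.
by have /andP [_ fgk] := fg k; exact: le_trans (gCk k).
Qed.

Lemma subexponential_cst c : 0 <= c -> subexponential (fun=> c).
Proof.
move=> c0; split=> // t t1; exists c => k.
by rewrite ler_peMr// exprn_ege1// ltW.
Qed.

Lemma subexponential_id : subexponential (fun k => k%:R).
Proof.
split=> [k|t t1]; first exact: ler0n.
have t0 : 0 < t - 1 by rewrite subr_gt0.
exists (t - 1)^-1 => k; rewrite ler_pdivlMl//.
elim: k => [|k IHk]; first by rewrite mulr0 expr0.
have t1k : 1 <= t ^+ k by rewrite exprn_ege1// ltW.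
by rewrite exprS -natr1; nra.
Qed.

Lemma subexponentialD f g : subexponential f -> subexponential g ->
  subexponential (fun k => f k + g k).
Proof.
move=> [f0 fC] [g0 gC]; split=> [k|t t1]; first by rewrite addr_ge0.
have [C1 fC1] := fC t t1; have [C2 gC2] := gC t t1.
by exists (C1 + C2) => k; rewrite mulrDl lerD.
Qed.

Lemma subexponentialM f g : subexponential f -> subexponential g ->
  subexponential (fun k => f k * g k).
Proof.
move=> [f0 fC] [g0 gC]; split=> [k|t t1]; first by rewrite mulr_ge0.
have s1 : 1 < Num.sqrt t by rewrite -sqrtr1 ltr_sqrt// (lt_trans _ t1).
have [C1 fC1] := fC _ s1; have [C2 gC2] := gC _ s1.
exists (C1 * C2) => k.
have -> : C1 * C2 * t ^+ k = (C1 * Num.sqrt t ^+ k) * (C2 * Num.sqrt t ^+ k).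
  rewrite mulrACA -exprMn -expr2 sqr_sqrtr//; lra.
by rewrite ler_pM.
Qed.

Lemma subexponentialX f d : subexponential f ->
  subexponential (fun k => f k ^+ d).
Proof.
move=> fs; elim: d => [|d IHd]; first exact: subexponential_cst.
apply: subexponential_le (subexponentialM fs IHd) => k.
by rewrite exprS lexx mulr_ge0// ?exprn_ge0//; apply: fs.1.
Qed.

Lemma subexponential_decay f (lam : R) : subexponential f -> 0 < lam < 1 ->
  exists C mu, [/\ 0 <= C, 0 < mu < 1 & forall k, f k * lam ^+ k <= C * mu ^+ k].
Proof.
move=> [f0 fC] /andP [lam0 lam1].
pose mu := (1 + lam) / 2.
have mu1 : lam < mu by rewrite /mu; lra.
have t1 : 1 < mu / lam by rewrite ltr_pdivlMr// mul1r.
have [C fCk] := fC _ t1.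
have C0 : 0 <= C.
  by have := le_trans (f0 0) (fCk 0); rewrite expr0 mulr1.
exists C, mu; split=> // [|k]; first by rewrite /mu; lra.
have -> : C * mu ^+ k = C * (mu / lam) ^+ k * lam ^+ k.
  by rewrite -mulrA -exprMn divfK// gt_eqF.
by rewrite ler_wpM2r// exprn_ge0// ltW.
Qed.

Lemma cvg_geometric_steps (E : completeNormedModType R) (u : nat -> E)
    (C mu : R) : 0 <= C -> 0 < mu < 1 ->
  (forall k, `|u k - u k.+1| <= C * mu ^+ k) -> cvgn u.
Proof.
move=> C0 /andP [mu0 mu1] uC.
have cs : cvgn (series (telescope u)).
  apply: normed_cvg; apply: (series_le_cvg (v_ := geometric C mu)).
  - by move=> k; exact: normr_ge0.
  - by move=> k; rewrite /= mulr_ge0// exprn_ge0// ltW.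
  - by move=> k; rewrite /= /telescope distrC.
  - by apply: is_cvg_geometric_series; rewrite gtr0_norm.
have -> : u = (fun n => u 0%N + series (telescope u) n).
  by apply/funext => n; rewrite -eq_sum_telescope.
by apply: is_cvgD => //; exact: is_cvg_cst.
Qed.

End Subexponential.

(** * The fixed point *)

Section FixedPoint.
Variables (m : nat) (R : realType) (E : completeNormedModType R).
Local Notation A := (mpoly m int).
Local Notation G := (steinberg_group A).
Local Notation x := (@root_elt A).
Variable rho : G -> E -> E.
Hypothesis rhoP : isometric_midpoint_action rho.

(** The monomials generate the additive group of the polynomial ring. *)
Lemma fixed_by_root_subgroup (i j : 'I_3) w :
  (forall M : monomial m, rho (x i j (mono M)) w = w) ->
  forall p, rho (x i j p) w = w.
Proof.
move=> fixM.
have fixD p q : rho (x i j p) w = w -> rho (x i j q) w = w ->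
    rho (x i j (p + q)) w = w.
  by move=> pw qw; rewrite root_eltD (mactM rhoP) qw.
have fix0 : rho (x i j 0) w = w.
  apply: (can_inj (mactVK rhoP (x i j 0))).
  by rewrite -(mactM rhoP) -root_eltD addr0.
have fixN p : rho (x i j p) w = w -> rho (x i j (- p)) w = w.
  by move=> pw; rewrite (additiveN (@root_eltD _ i j)) -[in LHS]pw (mactVK rhoP).
have fixMn p n : rho (x i j p) w = w -> rho (x i j (p *+ n)) w = w.
  by move=> pw; elim: n => [|n IHn]; rewrite ?mulr0n// mulrS; exact: fixD.
elim/mpolyind => // c I p _ _ pw; apply: fixD => //.
have XI : rho (x i j (mpolyX int I)) w = w.
  by have := fixM (0%N, I); rewrite /mono expr0 mul1r.
rewrite -[c]intz scaler_int; case: c => n; first exact: fixMn.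
by rewrite NegzE mulrNz; exact/fixN/fixMn.
Qed.

Variables (pi : G -> E -> E) (lam : R).
Hypothesis piP : isometric_representation pi.
Hypothesis piB : forall g v w, pi g (v - w) = rho g v - rho g w.
Hypotheses (lam47 : 4 / 7 <= lam) (lam1 : lam < 1).
Hypothesis contraction : forall u w : E, `|w| = `|u| ->
  16^-1 * `|u| <= `|u - w| -> `|2^-1 *: (u + w)| <= lam * `|u|.
Variables (i j l : 'I_3).
Hypotheses (ij : i != j) (jl : j != l) (il : i != l).

Lemma root_fixed_point : exists w, forall p, rho (x i l p) w = w.
Proof.
pose v : E := 0.
have [C C0 HC] := root_displacement rhoP v.
(* Quadratic, to leave room for [k] factors of degree [3 k]; shifted by 5 to
   keep the ratio of consecutive sizes below 3/2. *)
pose n k := (4 * (k + 5) ^ 2)%N.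
pose D k := (8 * n k.+1)%N.
pose L k : R := C * (D k * D k)%:R.
pose S k : R := (size (monos m (D k)))%:R.
pose W k : R := L k * (1 + 12 * S k).
pose f k : R := 12 * (S k * S k * (32 * W k)).
have D0 k : (0 < D k)%N by rewrite /D /n; lia.
have LD k a b (M : monomial m) : (mono_deg M <= D k)%N ->
    `|rho (x a b (mono M)) v - v| <= L k.
  by move=> MD; exact: HC.
have L0 k : 0 <= L k by rewrite mulr_ge0.
have S0 k : 0 <= S k by exact: ler0n.
have W0 k : 0 <= W k by rewrite mulr_ge0// addr_ge0// mulr_ge0.
have Dsub : subexponential (fun k => (D k)%:R : R).
  apply: (@subexponential_le _ _
    (fun k => 32 * ((k%:R + 6) * (k%:R + 6)))) => [k|].
    rewrite ler0n /D /n /= -[6]/(6%:R) -!natrD -!natrM ler_nat.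
    by rewrite -mulnn; lia.
  by do ?[apply: subexponentialM|apply: subexponentialD
    |exact: subexponential_id|exact: subexponential_cst].
have Lsub : subexponential L.
  apply: (@subexponential_le _ _ (fun k => C * ((D k)%:R * (D k)%:R))) => [k|].
    by rewrite L0 /L natrM lexx.
  by do ?[apply: subexponentialM|exact: subexponential_cst|exact: Dsub].
have Ssub : subexponential S.
  apply: (@subexponential_le _ _ (fun k => (D k)%:R * (D k)%:R ^+ m)) => [k|].
    by rewrite S0 /S -natrX -natrM ler_nat size_monos.
  by apply: subexponentialM => //; exact: subexponentialX.
have fsub : subexponential f.
  by rewrite /f /W; do ?[exact: Lsub|exact: Ssub|exact: subexponential_cst
    |apply: subexponentialM|apply: subexponentialD].
have lam01 : 0 < lam < 1 by move: lam47 lam1; lra.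
have [B [mu [B0 mu01 fB]]] := subexponential_decay fsub lam01.
pose u k := walk rho (hexagon i j l (n k)) v.
have step k : `|u k - u k.+1| <= B * mu ^+ k.
  apply: le_trans (fB k); rewrite /f.
  have -> : 12 * (S k * S k * (32 * W k)) * lam ^+ k =
    12 * (S k * S k * (lam ^+ k * (32 * W k))) by ring.
  apply: (hexagon_step rhoP piP piB lam47 (ltW lam1) contraction (LD k)
    ij jl il); rewrite /D /n; clear; rewrite -?mulnn; lia.
have inv M k : (mono_deg M <= k)%N ->
    `|rho (x i l (mono M)) (u k) - u k| <= B * mu ^+ k.
  move=> Mk; apply: le_trans (fB k).
  apply: (@le_trans _ _ (2 ^- k * W k)).
    by apply: (hexagon_displacement rhoP (LD k)) => //;
      rewrite /D /n -?mulnn; move: Mk; clear; lia.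
  have S1 : 1 <= S k.
    rewrite ler1n; have : (0%N, mnm0) \in monos m (D k).
      by rewrite mem_monos /mono_deg /= mdeg0 D0.
    by case: (monos m (D k)).
  have lamk : 2 ^- k <= lam ^+ k.
    by rewrite -exprVn lerXn2r ?nnegrE ?invr_ge0//; move: lam47; lra.
  rewrite /f mulrC.
  have -> : 12 * (S k * S k * (32 * W k)) * lam ^+ k =
    W k * (lam ^+ k * (384 * (S k * S k))) by ring.
  rewrite ler_wpM2l// (le_trans lamk)// ler_peMr//.
    by rewrite exprn_ge0// (le_trans _ lam47).
  by have := ler_pM ler01 ler01 S1 S1; rewrite mulr1; lra.
have cu : cvgn u by exact: cvg_geometric_steps step.
exists (limn u); apply: fixed_by_root_subgroup => M.
apply/eqP; rewrite -subr_eq0 -normr_le0; apply/ler_addgt0Pr => e e0.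
rewrite add0r; have e3 : 0 < e / 3 by lra.
near (\oo)%classic => k.
have dk : `|limn u - u k| <= e / 3.
  by near: k; apply: cvgr_dist_le e3; exact: cu.
have gk : `|0 - geometric B mu k| <= e / 3.
  near: k; apply: cvgr_dist_le e3; apply: cvg_geometric.
  by case/andP: mu01 => mu0 mu1; rewrite gtr0_norm.
have Mk : (mono_deg M <= k)%N by near: k; exact: nbhs_infty_ge.
have := displacement_dist rhoP (x i l (mono M)) (u k) (limn u).
have := inv M k Mk.
have : B * mu ^+ k <= e / 3 by move: gk; rewrite sub0r normrN; exact: le_trans (ler_norm _).
lra.
Unshelve. all: by end_near. Qed.

End FixedPoint.

Theorem theorem1p3 (R : realType) (m : nat) (alpha : A2_root) :
  relative_property_F_class (G := steinberg_group (mpoly m int))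
    (root_subgroup alpha) (@uniformly_convex R).
Proof.
case: alpha => -[i l] il E Euc rho [act1 actM act_affine act_iso _].
have [lam [lam47 lam1 contraction]] := uniformly_convex_contraction Euc.
have linear_partE g v w :
    linear_part rho g (v - w) = rho g v - rho g w.
  have [T [b Tb]] := act_affine g.
  by rewrite /linear_part !Tb linear0 add0r addrK linearB opprD addrACA subrr addr0.
have rhoP : isometric_midpoint_action rho.
  split=> // g v w; have [T [b Tb]] := act_affine g.
  by rewrite !Tb linearZ linearD /= [in RHS]addrACA [in RHS]scalerDr half_addrr.
have piP : isometric_representation (linear_part rho).
  split; last first.
    move=> g v w; have [T [b Tb]] := act_affine g.
    by rewrite /linear_part !Tb linear0 add0r !addrK linearD.
  split=> [v|g h v|g v w|g v w].
  - by rewrite /linear_part !act1 subr0.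
  - by rewrite [linear_part rho h v]/linear_part linear_partE /linear_part !actM.
  - have [T [b Tb]] := act_affine g.
    by rewrite /linear_part !Tb linear0 add0r !addrK linearZ linearD.
  - by rewrite /linear_part opprB addrA subrK act_iso.
have [j /andP [ji jl]] := third_index i l.
rewrite eq_sym in ji.
have [w fixw] := root_fixed_point rhoP piP linear_partE lam47 lam1 contraction
  ji jl il.
by exists w => _ [p _ <-]; rewrite -root_eltE fixw.
Qed.
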